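(* Let $n_x,n_y,n_z$ be pairwise relatively prime positive integers, and let $|\mathcal{L}(n_x,n_y,n_z)|$ denote the number of distinct knot types of Lissajous knots with frequencies $(n_x,n_y,n_z)$. Then $$|\mathcal{L}(n_x,n_y,n_z)|\le 2n_xn_y.$$ If furthermore $n_x=2$, then $$|\mathcal{L}(2,n_y,n_z)|\le 2n_y+1.$$
   Context: A Lissajous knot is a knot in $\mathbb{R}^3$ admitting a parameterization $K(t)=(\cos(n_xt+\phi_x),\cos(n_yt+\phi_y),\cos(n_zt+\phi_z))$, $0\le t\le 2\pi$, where the frequencies $n_x,n_y,n_z$ are integers and the phase shifts $\phi_x,\phi_y,\phi_z$ are real numbers (chosen so that the curve is embedded). $\mathcal{L}(n_x,n_y,n_z)$ denotes the set of knot types of all Lissajous knots with frequencies $n_x,n_y,n_z$, where a knot and its mirror image are considered equivalent. *)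

(* Defs.v *)
From HB Require Import structures.
From mathcomp Require Import all_boot all_order all_algebra.
From mathcomp Require Import all_classical all_reals all_analysis.
Set Implicit Arguments. Unset Strict Implicit. Unset Printing Implicit Defensive.
Import Order.TTheory GRing.Theory Num.Theory.
Import numFieldNormedType.Exports.
Local Open Scope ring_scope.
Local Open Scope classical_set_scope.

Notation point3 R := (R * R * R)%type.

Definition lissajous (R : realType) (nx ny nz : nat) (px py pz : R) (t : R)
  : point3 R :=
  (cos (nx%:R * t + px), cos (ny%:R * t + py), cos (nz%:R * t + pz)).

Definition lissajous_embedded (R : realType) (nx ny nz : nat) (px py pz : R) :=
  forall s t : R, 0 <= s < 2 * pi -> 0 <= t < 2 * pi ->
    lissajous nx ny nz px py pz s = lissajous nx ny nz px py pz t -> s = t.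

Definition lissajous_knot (R : realType) (nx ny nz : nat) (px py pz : R)
  : set (point3 R) :=
  [set lissajous nx ny nz px py pz t | t in `[0, 2 * pi]%classic].

Definition homeo3 (R : realType) (h : point3 R -> point3 R) :=
  continuous h /\ exists g : point3 R -> point3 R,
    [/\ continuous g, cancel h g & cancel g h].

(* Knot type equivalence, where a knot and its mirror image are identified:
   K1 ~ K2 iff some (orientation preserving or reversing) homeomorphism of
   R^3 maps K1 onto K2. *)
Definition knot_equiv (R : realType) (K1 K2 : set (point3 R)) :=
  exists h, homeo3 h /\ h @` K1 = K2.

(* |L(nx,ny,nz)| <= N : there are no N+1 pairwise inequivalent Lissajous
   knots with frequencies nx, ny, nz. *)
Definition num_lissajous_types_le (R : realType) (nx ny nz N : nat) :=
  forall (k : nat) (ph : 'I_k -> R * R * R),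
    (forall i, lissajous_embedded nx ny nz (ph i).1.1 (ph i).1.2 (ph i).2) ->
    (forall i j, i != j ->
       ~ knot_equiv (lissajous_knot nx ny nz (ph i).1.1 (ph i).1.2 (ph i).2)
                    (lissajous_knot nx ny nz (ph j).1.1 (ph j).1.2 (ph j).2)) ->
    (k <= N)%N.

(* Main.v *)
(** The projection of the curve to the (x, y)-plane depends on one parameter psi;
    after a shift of time and reflections 0 < psi < pi. In the angles
    (th1, th2) with x = cos th1, y = cos th2 it is a billiard path in a square,
    and a homeomorphism of the plane acting on ny th1 + nx th2 and ny th1 - nx th2
    changes psi, so all these projections are equivalent. A homeomorphism of
    space that is affine on vertical lines then shows that the knot type depends
    only on the signs at the crossings. At the two kinds of crossings these are
    the signs of sin (j pi / nx + u) and sin (j pi / ny + v), so they are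
    determined by A = floor (nx u / pi) modulo 2 nx and B = floor (ny v / pi)
    modulo 2 ny. The reflection in z adds (nx, ny) to (A, B), hence only
    D = ny A + nx B modulo 2 nx ny matters, and the reversal of time acts by
    D |-> c - D. This leaves at most nx ny + 1 classes, which is at most
    2 nx ny, and equal to 2 ny + 1 for nx = 2.

    If a frequency is 1, the projection may be degenerate, but then all embedded
    curves are unknotted by an explicit fibrewise similarity. *)

Require Import Defs.
From mathcomp Require Import all_boot all_order all_algebra.
From mathcomp Require Import all_classical all_reals all_analysis.
From mathcomp Require Import ring lra zify.
Set Implicit Arguments. Unset Strict Implicit. Unset Printing Implicit Defensive.
Import Order.TTheory GRing.Theory Num.Theory.
Import numFieldNormedType.Exports.
Local Open Scope ring_scope.
Local Open Scope classical_set_scope.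

(** * Continuity *)

Section Continuity.
Context {R : realType} {T : topologicalType}.
Implicit Types f g : T -> R.

Lemma cts_id : continuous (fun x : T => x).
Proof. by move=> x; exact: cvg_id. Qed.

Lemma cts_cst (U : topologicalType) (c : U) : continuous (fun _ : T => c).
Proof. by move=> x; exact: cvg_cst. Qed.

Lemma cts_add f g :
  continuous f -> continuous g -> continuous (fun x => f x + g x).
Proof. by move=> cf cg x; exact: (cvgD (cf x) (cg x)). Qed.

Lemma cts_opp f : continuous f -> continuous (fun x => - f x).
Proof. by move=> cf x; exact: (cvgN (cf x)). Qed.

Lemma cts_mul f g :
  continuous f -> continuous g -> continuous (fun x => f x * g x).
Proof. by move=> cf cg x; exact: (cvgM (cf x) (cg x)). Qed.

Lemma cts_inv f :
  continuous f -> (forall x, f x != 0) -> continuous (fun x => (f x)^-1).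
Proof. by move=> cf f0 x; apply: cvgV; [exact: f0|exact: cf]. Qed.

Lemma cts_exp f n : continuous f -> continuous (fun x => f x ^+ n).
Proof.
move=> cf; elim: n => [|n ihn]; first by under eq_fun do rewrite expr0; exact: cts_cst.
by under eq_fun do rewrite exprS; exact: cts_mul.
Qed.

Lemma cts_min f g :
  continuous f -> continuous g -> continuous (fun x => Num.min (f x) (g x)).
Proof. by move=> cf cg x; exact: continuous_min (cf x) (cg x). Qed.

Lemma cts_max f g :
  continuous f -> continuous g -> continuous (fun x => Num.max (f x) (g x)).
Proof. by move=> cf cg x; exact: continuous_max (cf x) (cg x). Qed.

Lemma cts_comp (U V : topologicalType) (g : U -> V) (f : T -> U) :
  continuous g -> continuous f -> continuous (fun x => g (f x)).
Proof. by move=> cg cf x; exact: (continuous_comp (cf x) (cg (f x))). Qed.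

Lemma cts_pair (U V : topologicalType) (f : T -> U) (g : T -> V) :
  continuous f -> continuous g -> continuous (fun x => (f x, g x)).
Proof. by move=> cf cg x; apply: cvg_pair; [exact: cf|exact: cg]. Qed.

Lemma cts_fst (U V : topologicalType) (f : T -> U * V) :
  continuous f -> continuous (fun x => (f x).1).
Proof. by move=> cf; apply: cts_comp cf => x; exact: cvg_fst. Qed.

Lemma cts_snd (U V : topologicalType) (f : T -> U * V) :
  continuous f -> continuous (fun x => (f x).2).
Proof. by move=> cf; apply: cts_comp cf => x; exact: cvg_snd. Qed.

Lemma cts_cos f : continuous f -> continuous (fun x => cos (f x)).
Proof. by apply: cts_comp; exact: continuous_cos. Qed.

Lemma cts_sin f : continuous f -> continuous (fun x => sin (f x)).
Proof. by apply: cts_comp; exact: continuous_sin. Qed.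

Lemma cts_atan f : continuous f -> continuous (fun x => atan (f x)).
Proof. by apply: cts_comp; exact: continuous_atan. Qed.

Lemma cts_expR f : continuous f -> continuous (fun x => expR (f x)).
Proof. by apply: cts_comp; exact: continuous_expR. Qed.

End Continuity.

(* [ctsf] only hides the leading quantifier of [continuous], so that [cts] can
   match on the body of the function without unfolding anything. *)
Definition ctsf (T U : topologicalType) (f : T -> U) := continuous f.

Ltac cts_step := lazymatch goal with
  | |- ctsf (fun x => x) => exact (@cts_id _)
  | |- ctsf (fun x => (@?f x, @?g x)) => apply: (@cts_pair _ _ _ f g); cts_go
  | |- ctsf (fun x => @?f x + @?g x) => apply: (@cts_add _ _ f g); cts_go
  | |- ctsf (fun x => - @?f x) => apply: (@cts_opp _ _ f); cts_go
  | |- ctsf (fun x => @?f x * @?g x) => apply: (@cts_mul _ _ f g); cts_go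
  | |- ctsf (fun x => (@?f x) ^+ _) => apply: (@cts_exp _ _ f); cts_go
  | |- ctsf (fun x => (@?f x) ^-1) => apply: (@cts_inv _ _ f); [cts_go|]
  | |- ctsf (fun x => Num.min (@?f x) (@?g x)) => apply: (@cts_min _ _ f g); cts_go
  | |- ctsf (fun x => Num.max (@?f x) (@?g x)) => apply: (@cts_max _ _ f g); cts_go
  | |- ctsf (fun x => cos (@?f x)) => apply: (@cts_cos _ _ f); cts_go
  | |- ctsf (fun x => sin (@?f x)) => apply: (@cts_sin _ _ f); cts_go
  | |- ctsf (fun x => atan (@?f x)) => apply: (@cts_atan _ _ f); cts_go
  | |- ctsf (fun x => expR (@?f x)) => apply: (@cts_expR _ _ f); cts_go
  | |- ctsf (fun x => (@?f x).1) => apply: (@cts_fst _ _ _ f); cts_go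
  | |- ctsf (fun x => (@?f x).2) => apply: (@cts_snd _ _ _ f); cts_go
  | |- ctsf (fun x => ?h (@?f x)) =>
      apply: (@cts_comp _ _ _ h f); [first [assumption|cts_go]|cts_go]
  | |- _ => assumption
  end
with cts_go := lazymatch goal with
  | |- ctsf _ => first
      [ lazymatch goal with |- ctsf (fun x => ?c) => exact (@cts_cst _ _ c) end
      | cts_step ]
  | |- forall x, continuous_at x ?f => change (ctsf f); cts_go
  end.
Ltac cts := cbv beta; cts_go.

(** * Extension theorems in the plane *)

Section Extension.
Variable R : realType.
Implicit Types (p q : R * R).

Lemma prodR_hausdorff : hausdorff_space (R * R)%type.
Proof. exact: norm_hausdorff. Qed.

(** On the compact image of the segment the factor of [f] is continuous, because its preimages of
    closed sets are images of compact sets; Tietze's theorem then extends it to the plane. *)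
Lemma factor_through_curve (a b : R) (g : R -> R * R) (f : R -> R) :
  a <= b -> continuous g -> continuous f ->
  (forall s t, a <= s <= b -> a <= t <= b -> g s = g t -> f s = f t) ->
  exists be : R * R -> R, continuous be /\
    forall t, a <= t <= b -> be (g t) = f t.
Proof.
move=> ab cg cf fg.
pose I : set R := [set t | a <= t <= b].
have IE : I = `[a, b]%classic by rewrite set_itvcc.
have cI : compact I by rewrite IE; exact: segment_compact.
have comp_img (C : set R) : closed C -> compact (g @` (I `&` C)).
  move=> cC; apply: continuous_compact; first exact: continuous_subspaceT.
  exact: compact_closedI.
pose A := g @` I.
have clA : closed A.
  apply: compact_closed; first exact: prodR_hausdorff.
  by have := comp_img setT closedT; rewrite setIT.
(* The default [a] is taken only off the curve. *)
pose h q : R := f (xget a [set t | I t /\ g t = q]).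
have hE t : I t -> h (g t) = f t.
  move=> It; rewrite /h; case: xgetP => [s _ [Is gst]|/(_ t)/=];
    first exact: (fg _ _ Is It gst).
  by move=> /not_andP[].
have ch : {within A, continuous h}.
  apply/continuous_closedP => C clC; apply/closed_subspaceP.
  exists (g @` (I `&` (f @^-1` C))).
    apply: compact_closed; first exact: prodR_hausdorff.
    apply: comp_img; exact: (closed_comp (fun x _ => cf x) clC).
  apply/seteqP; split => [q [[t [It Ct] <-] _]|q [Ch [t It tq]]].
    split; last by exists t.
    by have : C (h (g t)) by rewrite hE.
  by split; [exists t => //; split=> //=; rewrite -hE // tq|exists t].
have [M [_ MP]] : bounded_set (f @` I).
  by apply: compact_bounded; apply: continuous_compact => //;
    exact: continuous_subspaceT.
(* Adding 1 makes the bound positive, as Tietze requires, and larger than [M], as [MP] requires. *)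
pose M' := `|M| + 1.
have M'0 : 0 < M' by rewrite ltr_wpDl.
have hM q : A q -> `|h q| <= M'.
  case=> t It <-; rewrite hE //; apply: (MP M'); last by exists t.
  by rewrite (le_lt_trans (ler_norm M)) // ltrDl.
have [be [beE cbe _]] :=
  continuous_bounded_extension pseudometric_normal clA M'0 ch hM.
exists be; split => // t It; rewrite -beE ?hE //.
by apply/mem_set; exists t.
Qed.

Definition sqdist p q : R := (p.1 - q.1) ^+ 2 + (p.2 - q.2) ^+ 2.

Lemma sqdist_eq0 p q : (sqdist p q == 0) = (p == q).
Proof.
rewrite /sqdist paddr_eq0 ?sqr_ge0 // !sqrf_eq0 !subr_eq0.
by case: p q => [? ?] [? ?].
Qed.

(** Each new point contributes the exponential of a multiple of the product of squared distances to
    the earlier points: this keeps positivity and equals 1 at those points. *)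
Lemma interpolate_pos (s : seq (R * R)) (v : R * R -> R) :
  (forall q, 0 < v q) ->
  exists al : R * R -> R, [/\ continuous al, forall q, 0 < al q &
    forall q, q \in s -> al q = v q].
Proof.
move=> v0; elim: s => [|p s [al [cal al0 alE]]].
  by exists (fun=> 1); split => //; exact: cts_cst.
have [ps|ps] := boolP (p \in s).
  by exists al; split=> // q; rewrite inE => /orP[/eqP->|]; apply: alE.
pose w q := \prod_(r <- s) sqdist q r.
have cw : continuous w.
  rewrite /w; elim: {ps alE w} s => [|r s ihs].
    by under eq_fun do rewrite big_nil; exact: cts_cst.
  have -> : (fun q => \prod_(j <- r :: s) sqdist q j) =
      (fun q => sqdist q r * \prod_(j <- s) sqdist q j).
    by apply/funext => q; rewrite big_cons.
  by apply: cts_mul ihs; rewrite /sqdist; cts.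
have w0 q : q \in s -> w q = 0.
  move=> qs; apply/eqP; rewrite prodf_seq_eq0; apply/hasP; exists q => //=.
  by rewrite sqdist_eq0.
have wp : w p != 0.
  rewrite prodf_seq_eq0; apply/hasP => -[r rs /=]; rewrite sqdist_eq0 => /eqP pr.
  by rewrite pr rs in ps.
exists (fun q => al q * expR (ln (v p / al p) / w p * w q)); split.
- by cts.
- by move=> q; rewrite mulr_gt0 ?expR_gt0.
- move=> q; rewrite inE => /orP[/eqP->|qs]; last first.
    by rewrite (w0 q) // mulr0 expR0 mulr1 alE.
  rewrite mulfVK // lnK ?posrE ?divr_gt0 //.
  by rewrite mulrC mulfVK // gt_eqF.
Qed.

End Extension.

(** * Trigonometry *)

Section Trigonometry.
Variable R : realType.
Implicit Types x y : R.

(** The sign [e] is (-1)^p; it is kept abstract, what matters being that it squares to 1. *)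
Lemma sin_cosDpiz (p : int) : exists2 e : R, e * e = 1 &
  forall x, sin (x + p%:~R * pi) = e * sin x /\ cos (x + p%:~R * pi) = e * cos x.
Proof.
have nat_case (n : nat) : exists2 e : R, e * e = 1 &
    forall x, sin (x + n%:R * pi) = e * sin x /\ cos (x + n%:R * pi) = e * cos x.
  elim: n => [|n [e e1 ih]].
    by exists 1; rewrite ?mul1r // => x; rewrite mul0r addr0 !mul1r.
  exists (- e) => [|x]; first by rewrite mulrNN.
  have -> : x + n.+1%:R * pi = x + n%:R * pi + pi by ring.
  by rewrite sinDpi cosDpi !(ih x).1 !(ih x).2 !mulNr.
case: (intP p) => [|n|n]; [exact: (nat_case 0)|exact: (nat_case n.+1)|].
have [e e1 ih] := nat_case n.+1; exists e => // x.
have := ih (x + (- n.+1%:Z)%:~R * pi).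
have -> : x + (- n.+1%:Z)%:~R * pi + n.+1%:R * pi = x by ring.
by move=> [-> ->]; rewrite !mulrA e1 !mul1r.
Qed.

Lemma cosD2piz (p : int) x : cos (x + p%:~R * (2 * pi)) = cos x.
Proof.
have [e e1 He] := sin_cosDpiz p.
have -> : x + p%:~R * (2 * pi) = x + p%:~R * pi + p%:~R * pi by ring.
by rewrite (He _).2 (He _).2 mulrA e1 mul1r.
Qed.

Lemma sinD2piz (p : int) x : sin (x + p%:~R * (2 * pi)) = sin x.
Proof.
have [e e1 He] := sin_cosDpiz p.
have -> : x + p%:~R * (2 * pi) = x + p%:~R * pi + p%:~R * pi by ring.
by rewrite (He _).1 (He _).1 mulrA e1 mul1r.
Qed.

Lemma sin_piz (p : int) : sin (p%:~R * pi) = 0 :> R.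
Proof. by have [e _ /(_ 0)[+ _]] := sin_cosDpiz p; rewrite add0r sin0 mulr0. Qed.

Lemma floor_pi x : exists p : int, p%:~R * pi <= x < (p + 1)%:~R * pi.
Proof.
exists (Num.floor (x / pi)).
by rewrite -ler_pdivlMr ?pi_gt0 // -ltr_pdivrMr ?pi_gt0 // Num.Theory.floor_le
  Num.Theory.floorD1_gt.
Qed.

Lemma sin_eq0_piz x : sin x = 0 -> exists p : int, x = p%:~R * pi.
Proof.
have [p /andP[px xp]] := floor_pi x => sx; exists p.
have [e e1 He] := sin_cosDpiz p.
have sp : sin (x - p%:~R * pi) = 0.
  have := (He (x - p%:~R * pi)).1; rewrite subrK sx => /esym/eqP.
  by rewrite mulf_eq0 => /orP[/eqP e0|/eqP//]; move: e1; rewrite e0 mul0r; lra.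
rewrite intrD in xp; move: px; rewrite le_eqVlt => /orP[/eqP//|px].
have : 0 < sin (x - p%:~R * pi) by apply: sin_gt0_pi; lra.
by rewrite sp ltxx.
Qed.

Lemma subr_cos x y : cos x - cos y = - 2 * sin ((x + y) / 2) * sin ((x - y) / 2).
Proof.
have -> : cos x = cos ((x + y) / 2 + (x - y) / 2) by congr cos; field.
have -> : cos y = cos ((x + y) / 2 - (x - y) / 2) by congr cos; field.
by rewrite cosD cosB; ring.
Qed.

Lemma cos_eqP x y : cos x = cos y ->
  exists p : int, x = y + p%:~R * (2 * pi) \/ x = - y + p%:~R * (2 * pi).
Proof.
move/eqP; rewrite -subr_eq0 subr_cos -mulrA mulf_eq0 oppr_eq0 pnatr_eq0 /=.
rewrite mulf_eq0 => /orP[/eqP|/eqP] /sin_eq0_piz[p Hp]; exists p; [right|left].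
  by have -> : x = (x + y) / 2 * 2 - y; [field|rewrite Hp; ring].
by have -> : x = (x - y) / 2 * 2 + y; [field|rewrite Hp; ring].
Qed.

Lemma coprime_solve (m n : nat) (j : int) : coprime m n ->
  exists k l : int, k * m%:Z + l * n%:Z = j.
Proof.
move=> mn; have /coprimezP[[u v] /= uv] : coprimez m n by [].
by exists (j * u), (j * v); rewrite -!mulrA -mulrDr uv mulr1.
Qed.

Lemma coprime_2piz (m n : nat) x (p q : int) : coprime m n ->
  m%:R * x = p%:~R * (2 * pi) -> n%:R * x = q%:~R * (2 * pi) ->
  exists r : int, x = r%:~R * (2 * pi).
Proof.
move=> mn mx nx; have [k [l kl]] := coprime_solve 1 mn.
exists (k * p + l * q).
have -> : x = (k * m%:Z + l * n%:Z)%:~R * x by rewrite kl mul1r.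
have -> : (k * m%:Z + l * n%:Z)%:~R * x = k%:~R * (m%:R * x) + l%:~R * (n%:R * x).
  by ring.
by rewrite mx nx; ring.
Qed.

(** The time [c] makes the first phase an integer multiple of pi; the Bezout decomposition of [j] by
    [m] and [n] chooses the multiple for which the second phase is one too. *)
Lemma coprime_phases (m n : nat) (a b : R) (j : int) : (0 < m)%N -> coprime m n ->
  m%:R * b - n%:R * a = j%:~R * pi ->
  exists c (k l : int), m%:R * c + a = k%:~R * pi /\ n%:R * c + b = l%:~R * pi.
Proof.
move=> m0 mn H; have [l [k kl]] := coprime_solve j mn.
have mR : m%:R != 0 :> R by rewrite pnatr_eq0 -lt0n.
exists (((- k)%:~R * pi - a) / m%:R), (- k), l; split; first by field.
have bE : b = (j%:~R * pi + n%:R * a) / m%:R by rewrite -H; field.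
by rewrite bE -kl; field.
Qed.

End Trigonometry.

(** * Knot equivalence *)

Section KnotEquiv.
Variable R : realType.
Implicit Types K : set (point3 R).

Lemma knot_equiv_sym K1 K2 : knot_equiv K1 K2 -> knot_equiv K2 K1.
Proof.
move=> [h [[ch [g [cg hg gh]]] <-]]; exists g; split; first by split => //; exists h.
by rewrite image_comp; under eq_imagel => x _ do rewrite /= hg; rewrite image_id.
Qed.

Lemma knot_equiv_trans K2 K1 K3 :
  knot_equiv K1 K2 -> knot_equiv K2 K3 -> knot_equiv K1 K3.
Proof.
move=> [h [[ch [g [cg hg gh]]] <-]] [h' [[ch' [g' [cg' hg' gh']]] <-]].
exists (h' \o h); split; last by rewrite image_comp.
split; first exact: cts_comp ch' ch.
exists (g \o g'); split; first exact: cts_comp cg cg'.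
  by move=> x /=; rewrite hg' hg.
by move=> x /=; rewrite gh gh'.
Qed.

Lemma knot_equiv_range (k1 k2 : R -> point3 R) h (tau : R -> R) :
  homeo3 h -> (forall t, exists s, tau s = t) ->
  (forall t, h (k1 t) = k2 (tau t)) -> knot_equiv (range k1) (range k2).
Proof.
move=> hh taus hk; exists h; split => //; apply/seteqP; split.
  by move=> _ [_ [t _ <-] <-]; exists (tau t).
by move=> _ [t _ <-]; have [s <-] := taus t; exists (k1 s) => //; exists s.
Qed.

Lemma fiberwise_homeo (al be : R * R -> R) :
  continuous al -> continuous be -> (forall q, 0 < al q) ->
  homeo3 (fun p : point3 R => (p.1, al p.1 * p.2 + be p.1)).
Proof.
move=> cal cbe al0; have alN q : al q != 0 by rewrite gt_eqF.
split; first by cts.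
exists (fun p => (p.1, (p.2 - be p.1) / al p.1)); split; first by cts.
  by case=> q z /=; congr pair; field.
by case=> q z /=; congr pair; field.
Qed.

Lemma prod_homeo (h g : R * R -> R * R) :
  continuous h -> continuous g -> cancel h g -> cancel g h ->
  homeo3 (fun p : point3 R => (h p.1, p.2)).
Proof.
move=> ch cg hg gh; split; first by cts.
exists (fun p => (g p.1, p.2)); split; first by cts.
  by case=> q z /=; rewrite hg.
by case=> q z /=; rewrite gh.
Qed.

(* Two space curves over the same plane curve, with the same order of the
   strands over each of the finitely many double points, differ by a homeomorphism
   which is affine on every vertical line: the slopes are prescribed at the double
   points only, and then the translation part is a well defined function on the
   plane curve. *)
Lemma fiberwise_equiv (g : R -> R * R) (z1 z2 : R -> R) (P : seq (R * R)) :
  continuous g -> continuous z1 -> continuous z2 ->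
  (forall (p : int) t, g (t + p%:~R * (2 * pi)) = g t) ->
  (forall (p : int) t, z1 (t + p%:~R * (2 * pi)) = z1 t) ->
  (forall (p : int) t, z2 (t + p%:~R * (2 * pi)) = z2 t) ->
  (forall s t, g s = g t -> g s \notin P -> z1 s = z1 t /\ z2 s = z2 t) ->
  (forall q, exists2 v, 0 < v &
     forall s t, g s = q -> g t = q -> z2 s - z2 t = v * (z1 s - z1 t)) ->
  exists2 h, homeo3 h & forall t, h (g t, z1 t) = (g t, z2 t).
Proof.
move=> cg c1 c2 pg p1 p2 gP gv.
have /choice[v vP] : forall q, exists v, 0 < v /\
    forall s t, g s = q -> g t = q -> z2 s - z2 t = v * (z1 s - z1 t).
  by move=> q; have [v v0 vE] := gv q; exists v.
have [al [cal al0 alE]] := interpolate_pos P (fun q => (vP q).1).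
have pi0 : 0 < pi :> R := pi_gt0 R.
pose f t := z2 t - al (g t) * z1 t.
have fg s t : g s = g t -> f s = f t.
  move=> st; rewrite /f st; have [tP|tP] := boolP (g t \in P); last first.
    by have [|-> ->] := gP s t st; rewrite ?st.
  have := (vP (g t)).2 s t st erefl; rewrite -alE // => H.
  by apply/eqP; rewrite -subr_eq0; apply/eqP;
    rewrite -[RHS](subrr (z2 s - z2 t)) {2}H; ring.
have [be [cbe beE]] : exists be : R * R -> R, continuous be /\
    forall t, 0 <= t <= 2 * pi -> be (g t) = f t.
  apply: factor_through_curve => //; first by lra.
    by rewrite /f; cts.
  by move=> s t _ _; exact: fg.
exists (fun p => (p.1, al p.1 * p.2 + be p.1)); first exact: fiberwise_homeo.
move=> t /=; congr pair.
(* Removing [p] periods brings [t] into the segment on which [be] was prescribed. *)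
have [p /andP[pt tp]] := floor_pi (t / 2).
have -> : be (g t) = f t.
  have := beE (t + (- p)%:~R * (2 * pi)); rewrite /f pg p1 p2; apply.
  by move: pt tp; rewrite !rmorphN !rmorphD /=; lra.
by rewrite /f; ring.
Qed.
End KnotEquiv.

(** * Deforming the planar Lissajous figure *)

Section Mobius.
Variable R : realType.
Implicit Types r a x y : R.

(* The lift to the line of the Moebius transformation z |-> (z - r) / (1 - r z)
   of the unit circle. *)
Definition mobius r a := a + 2 * atan (r * sin a / (1 - r * cos a)).

Lemma mobius_den r a : -1 < r < 1 -> 1 - r * cos a != 0.
Proof.
move=> r1; rewrite gt_eqF // subr_gt0 (@le_lt_trans _ _ `|r|) ?ltr_norml //.
by rewrite (le_trans (ler_norm _)) // normrM ler_piMr // cos_max.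
Qed.

Lemma mobius_cts r : -1 < r < 1 -> continuous (mobius r).
Proof.
move=> r1; rewrite /mobius; cts.
by move=> a /=; exact: mobius_den.
Qed.

Lemma mobiusN r a : mobius r (- a) = - mobius r a.
Proof. by rewrite /mobius sinN cosN mulrN mulNr atanN; ring. Qed.

Lemma mobiusD2piz r a (p : int) :
  mobius r (a + p%:~R * (2 * pi)) = mobius r a + p%:~R * (2 * pi).
Proof. by rewrite /mobius sinD2piz cosD2piz addrAC. Qed.

(** The displacement is [2 * u] with [tan u = T]. The half-angle formulas turn the definition of [T]
    into [key], which says that [mobius (- r)] displaces the image [m] by the opposite amount. *)
Lemma mobiusK r : -1 < r < 1 -> cancel (mobius r) (mobius (- r)).
Proof.
move=> r1 a; rewrite {1}/mobius; set m := mobius r a.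
set T := r * sin a / (1 - r * cos a); set u := atan T.
have rN : -1 < - r < 1 by lra.
have dm : 1 - - r * cos m != 0 by exact: mobius_den.
have TE : T * (1 - r * cos a) = r * sin a by rewrite /T mulfVK // mobius_den.
have cu0 : cos u != 0.
  by rewrite gt_eqF // cos_gt0_pihalf // atan_gtNpi2 atan_ltpi2.
have su : sin u = T * cos u.
  by have tT := atanK T; rewrite /tan -/u in tT; rewrite -tT mulfVK.
have cu : cos u * cos u * (1 + T * T) = 1.
  by rewrite -[RHS](cos2Dsin2 u) su; ring.
have T1 : 1 + T * T != 0 by apply/eqP => T0; move: cu; rewrite T0 mulr0; lra.
have mE : m = a + (u + u) by rewrite /m /mobius -/T -/u; ring.
have key : r * sin m = T * (1 + r * cos m).
  have cc : cos u * cos u = (1 + T * T)^-1 by apply: (mulIf T1); rewrite cu mulVf.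
  have s2 : sin (u + u) = 2 * T / (1 + T * T) by rewrite sinD su -cc; ring.
  have c2 : cos (u + u) = (1 - T * T) / (1 + T * T) by rewrite cosD su -cc; ring.
  rewrite mE (sinD a) (cosD a) s2 c2; apply/esym.
  rewrite -[RHS]addr0 -(subrr (r * sin a)) -{1}TE; field; exact: T1.
have -> : - r * sin m / (1 - - r * cos m) = - T.
  by apply: (mulIf dm); rewrite mulfVK // mulNr key; ring.
by rewrite atanN -/u mE; ring.
Qed.

(** The equation to solve for [r] is [tan de = r * sin psi1 / (1 - r * cos psi1)], with solution
    [sin de / sin si]. Its modulus is below 1 because the sines and cosines of the half-angles are
    positive. *)
Lemma mobius_transitive (psi1 psi2 : R) : 0 < psi1 < pi -> 0 < psi2 < pi ->
  exists2 r, -1 < r < 1 & mobius r psi1 = psi2.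
Proof.
move=> p1 p2; pose de := (psi2 - psi1) / 2; pose si := (psi1 + psi2) / 2.
have si0 : 0 < sin si by apply: sin_gt0_pi; rewrite /si; lra.
have s1 : 0 < sin (psi1 / 2) by apply: sin_gt0_pi; lra.
have s2 : 0 < sin (psi2 / 2) by apply: sin_gt0_pi; lra.
have c1 : 0 < cos (psi1 / 2) by apply: cos_gt0_pihalf; lra.
have c2 : 0 < cos (psi2 / 2) by apply: cos_gt0_pihalf; lra.
have siE : sin si = sin (psi1 / 2) * cos (psi2 / 2) + cos (psi1 / 2) * sin (psi2 / 2).
  by rewrite -sinD; congr sin; rewrite /si; field.
have deE : sin de = sin (psi2 / 2) * cos (psi1 / 2) - cos (psi2 / 2) * sin (psi1 / 2).
  by rewrite -sinB; congr sin; rewrite /de; field.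
have r1 : -1 < sin de / sin si < 1.
  rewrite ltr_pdivlMr // ltr_pdivrMr // siE deE.
  have h1 := mulr_gt0 s1 c2; have h2 := mulr_gt0 s2 c1; nra.
exists (sin de / sin si) => //; rewrite /mobius.
have cd0 : cos de != 0 by rewrite gt_eqF // cos_gt0_pihalf // /de; lra.
have d0 := mobius_den psi1 r1.
have -> : sin de / sin si * sin psi1 / (1 - sin de / sin si * cos psi1) = tan de.
  apply: (mulIf d0); rewrite mulfVK // /tan.
  have -> : sin de / sin si * sin psi1 = sin de / cos de * (sin psi1 * cos de / sin si).
    by field; rewrite cd0 gt_eqF.
  congr (_ * _); have siD : sin si = sin psi1 * cos de + cos psi1 * sin de.
    by rewrite -sinD; congr sin; rewrite /si /de; field.
  have -> : sin psi1 * cos de = sin si - cos psi1 * sin de by rewrite siD; ring.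
  by field; rewrite gt_eqF.
rewrite tanK; first by rewrite /de; field.
by rewrite in_itv /= /de; lra.
Qed.

(** A continuous injection on a segment is increasing once its end values are in order; the right
    end [z] is a translate of [x] by whole periods beyond [y], for which the order is known. *)
Lemma mobius_le r : -1 < r < 1 -> {homo mobius r : x y / x <= y}.
Proof.
move=> r1 x y xy; have pi0 := pi_gt0 R.
have [p /andP[_ yp]] := floor_pi (y - x).
have p0 : 0 <= (p + 1)%:~R :> R.
  by rewrite ltW // -(pmulr_lgt0 _ pi0); lra.
pose z := x + (p + 1)%:~R * (2 * pi).
have xz : x <= z by rewrite /z lerDl mulr_ge0 //; lra.
have yz : y <= z by rewrite /z; nra.
have fxz : mobius r x <= mobius r z by rewrite /z mobiusD2piz lerDl mulr_ge0 //; lra.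
have := @segment_continuous_inj_le R (mobius r) x z fxz
  (continuous_subspaceT (mobius_cts r1)) (in2W (can_inj (mobiusK r1))).
by move=> H; rewrite H // in_itv /= ?lexx ?xz ?xy ?yz.
Qed.

End Mobius.

(** * The cosine extended to a homeomorphism of the line *)

Section CosExtension.
Variable R : realType.
Implicit Types th x : R.

Definition clamp (lo hi x : R) := Num.max lo (Num.min x hi).

Lemma clampE (lo hi x : R) : lo <= hi ->
  [\/ x <= lo /\ clamp lo hi x = lo, lo <= x <= hi /\ clamp lo hi x = x |
      hi <= x /\ clamp lo hi x = hi].
Proof.
move=> lohi; rewrite /clamp; have [xhi|hix] := leP x hi; last first.
  by constructor 3; rewrite max_r // ltW.
have [xlo|lox] := leP x lo; first by constructor 1.
by constructor 2; split => //; rewrite ltW.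
Qed.

Lemma clamp_id (lo hi x : R) : lo <= x <= hi -> clamp lo hi x = x.
Proof. by move=> /andP[lox xhi]; rewrite /clamp min_l ?max_r. Qed.

Lemma clamp_bounds (lo hi x : R) : lo <= hi -> lo <= clamp lo hi x <= hi.
Proof. by move=> lohi; case: (clampE x lohi) => [] [H ->]; lra. Qed.

Lemma cts_clamp (T : topologicalType) (lo hi : R) (f : T -> R) :
  continuous f -> continuous (fun u => clamp lo hi (f u)).
Proof. by move=> cf; rewrite /clamp; cts. Qed.

(** Outside [[0, pi]] the cosine is continued with slope -1, which makes it a bijection of the line;
    [xacos] is the inverse. *)
Definition xcos th := cos (clamp 0 pi th) - (th - clamp 0 pi th).
Definition xacos x := acos (clamp (-1) 1 x) - (x - clamp (-1) 1 x).

Lemma xcos_id th : 0 <= th <= pi -> xcos th = cos th.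
Proof. by move=> H; rewrite /xcos clamp_id // subrr subr0. Qed.

Lemma xacos_cos th : 0 <= th <= pi -> xacos (cos th) = th.
Proof.
move=> H; rewrite /xacos clamp_id ?cos_geN1 ?cos_le1 // subrr subr0 cosK //.
Qed.

Lemma xcosK : cancel xcos xacos.
Proof.
move=> th; have pi0 := pi_ge0 R; rewrite /xcos; case: (clampE th pi0) => [][H ->].
- rewrite cos0 /xacos; case: (@clampE (-1) 1 (1 - (th - 0))); first by lra.
  + by move=> [H1 _]; lra.
  + by move=> [H1 ->]; have -> : 1 - (th - 0) = 1 by [lra]; rewrite acos1; lra.
  + by move=> [H1 ->]; rewrite acos1; lra.
- by rewrite subrr subr0 xacos_cos.
- rewrite cospi /xacos; case: (@clampE (-1) 1 (-1 - (th - pi))); first by lra.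
  + by move=> [H1 ->]; rewrite acosN1; lra.
  + by move=> [H1 ->]; have -> : -1 - (th - pi) = -1 by [lra]; rewrite acosN1; lra.
  + by move=> [H1 _]; lra.
Qed.

Lemma xacosK : cancel xacos xcos.
Proof.
move=> x; have pi0 := pi_gt0 R; have pi1 := pi_ge0 R.
have le11 : -1 <= 1 :> R by lra.
rewrite /xacos; case: (clampE x le11) => [][H ->].
- rewrite acosN1 /xcos; case: (clampE (pi - (x - -1)) pi1).
  + by move=> [H1 _]; lra.
  + by move=> [H1 ->]; have -> : pi - (x - -1) = pi by [lra]; rewrite cospi; lra.
  + by move=> [H1 ->]; rewrite cospi; lra.
- by rewrite subrr subr0 xcos_id ?acosK ?in_itv // acos_ge0 // acos_lepi.
- rewrite acos1 /xcos; case: (clampE (0 - (x - 1)) pi1).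
  + by move=> [H1 ->]; rewrite cos0; lra.
  + by move=> [H1 ->]; have -> : 0 - (x - 1) = 0 by [lra]; rewrite cos0; lra.
  + by move=> [H1 _]; lra.
Qed.

Lemma xcos_cts : continuous xcos.
Proof. by rewrite /xcos /clamp; cts. Qed.

Lemma xacos_cts : continuous xacos.
Proof.
have ca : {within `[(-1), 1]%classic, continuous (@acos R)}.
  have := @segment_can_ge_continuous R 0 pi cos acos (pi_ge0 R).
  rewrite cospi cos0; apply; last exact: cosK.
  by apply: continuous_subspaceT; exact: continuous_cos.
have cc : continuous (fun x : R => clamp (-1) 1 x) by apply: cts_clamp; exact: cts_id.
have cac : continuous (fun x : R => acos (clamp (-1) 1 x)).
  move=> x; have bx : `[(-1), 1]%classic (clamp (-1) 1 x).
    by rewrite /= in_itv /= clamp_bounds //; lra.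
  have /subspace_continuousP/(_ _ bx) := ca; apply: cvg_comp.
  move=> A /= wA; have := cc x _ wA; rewrite /= !nbhs_simpl /=.
  apply: filterS => y; apply; rewrite /= in_itv /= clamp_bounds //; lra.
rewrite /xacos; apply: cts_add => //; cts.
Qed.

End CosExtension.

(** * Plane homeomorphisms changing the parameter psi *)

Section PlanarDeformation.
Variables (R : realType) (nx ny : nat).
Hypotheses (nx0 : (0 < nx)%N) (ny0 : (0 < ny)%N).
Implicit Types th q : R * R.

Let nxR : nx%:R != 0 :> R. Proof. by rewrite pnatr_eq0 -lt0n. Qed.
Let nyR : ny%:R != 0 :> R. Proof. by rewrite pnatr_eq0 -lt0n. Qed.

(* In the angular coordinates (th1, th2) the planar curve is a billiard path,
   made of the lines ny th1 + nx th2 = +- psi and ny th1 - nx th2 = +- psi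
   modulo 2 pi; hence a circle homeomorphism acting on both these linear forms
   changes psi, and it respects the folding by cos in each coordinate. *)
Definition billiard_map (r : R) th : R * R :=
  let a := mobius r (ny%:R * th.1 + nx%:R * th.2) in
  let b := mobius r (ny%:R * th.1 - nx%:R * th.2) in
  ((a + b) / (2 * ny%:R), (a - b) / (2 * nx%:R)).

Lemma billiard_mapK r : -1 < r < 1 -> cancel (billiard_map r) (billiard_map (- r)).
Proof.
move=> r1 [t1 t2]; rewrite /billiard_map /=.
set a := mobius r (_ + _); set b := mobius r (_ - _).
have -> : ny%:R * ((a + b) / (2 * ny%:R)) + nx%:R * ((a - b) / (2 * nx%:R)) = a.
  by field; rewrite nxR nyR.
have -> : ny%:R * ((a + b) / (2 * ny%:R)) - nx%:R * ((a - b) / (2 * nx%:R)) = b.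
  by field; rewrite nxR nyR.
by rewrite /a /b !mobiusK //; congr pair; field.
Qed.

Lemma billiard_map_cts r : -1 < r < 1 -> continuous (billiard_map r).
Proof.
move=> r1; have cm := mobius_cts r1; rewrite /billiard_map /=; cts.
Qed.

(** In the two linear forms a and b, the square is given by [- b <= a], [b <= a],
    [a <= - b + 2 ny pi] and [a <= b + 2 nx pi]. An odd increasing map commuting with translations
    by 2 pi preserves all four. *)
Lemma billiard_map_square r th : -1 < r < 1 -> 0 <= th.1 <= pi -> 0 <= th.2 <= pi ->
  0 <= (billiard_map r th).1 <= pi /\ 0 <= (billiard_map r th).2 <= pi.
Proof.
case: th => t1 t2 /= r1 h1 h2; rewrite /billiard_map /=.
have mh := mobius_le r1.
have x0 : 0 < nx%:R :> R by rewrite ltr0n.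
have y0 : 0 < ny%:R :> R by rewrite ltr0n.
set A := ny%:R * t1 + nx%:R * t2; set B := ny%:R * t1 - nx%:R * t2.
have k1 : - mobius r B <= mobius r A.
  by rewrite -mobiusN mh // /A /B; nra.
have k2 : mobius r B <= mobius r A by rewrite mh // /A /B; nra.
have k3 : mobius r A <= - mobius r B + ny%:~R * (2 * pi).
  rewrite -mobiusN -mobiusD2piz mh // /A /B; nra.
have k4 : mobius r A <= mobius r B + nx%:~R * (2 * pi).
  rewrite -mobiusD2piz mh // /A /B; nra.
rewrite !ler_pdivlMr ?ler_pdivrMr ?mulr_gt0 // !mul0r.
move: k1 k2 k3 k4; rewrite -!pmulrn => k1 k2 k3 k4.
split; apply/andP; split; lra.
Qed.

Definition plane_map (r : R) q : R * R :=
  let th := billiard_map r (xacos q.1, xacos q.2) in (xcos th.1, xcos th.2).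

Lemma plane_mapK r : -1 < r < 1 -> cancel (plane_map r) (plane_map (- r)).
Proof.
move=> r1 [x y].
have E a b : plane_map (- r) (xcos a, xcos b) =
    (xcos (billiard_map (- r) (a, b)).1, xcos (billiard_map (- r) (a, b)).2).
  by rewrite /plane_map /= !xcosK.
rewrite [plane_map r _]/plane_map; cbv zeta.
by rewrite E -surjective_pairing billiard_mapK //= !xacosK.
Qed.

Lemma plane_map_cts r : -1 < r < 1 -> continuous (plane_map r).
Proof.
move=> r1; have cb := billiard_map_cts r1; have ca := @xacos_cts R.
have cc := @xcos_cts R.
have cB : continuous (fun q : R * R => billiard_map r (xacos q.1, xacos q.2)) by cts.
exact: (cts_pair (cts_comp cc (cts_fst cB)) (cts_comp cc (cts_snd cB))).
Qed.

Lemma foldE (th : R) : exists2 th0, 0 <= th0 <= pi &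
  exists p : int, th = th0 + p%:~R * (2 * pi) \/ th = - th0 + p%:~R * (2 * pi).
Proof.
exists (acos (cos th)); first by rewrite acos_ge0 ?acos_lepi // cos_geN1 cos_le1.
by apply: cos_eqP; rewrite acosK // in_itv /= cos_geN1 cos_le1.
Qed.

(** On the square this is the construction of [plane_map]. Both sides respect sign changes and 2 pi
    translations of each angle, and these bring every angle into [[0, pi]]. *)
Lemma plane_map_cos r (t1 t2 : R) : -1 < r < 1 ->
  plane_map r (cos t1, cos t2) =
  (cos (billiard_map r (t1, t2)).1, cos (billiard_map r (t1, t2)).2).
Proof.
move=> r1.
pose P t1 t2 := plane_map r (cos t1, cos t2) =
  (cos (billiard_map r (t1, t2)).1, cos (billiard_map r (t1, t2)).2).
have P1 s t (p : int) : P s t -> P (s + p%:~R * (2 * pi)) t.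
  rewrite /P cosD2piz => ->; rewrite /billiard_map /=.
  have -> : ny%:R * (s + p%:~R * (2 * pi)) + nx%:R * t =
    ny%:R * s + nx%:R * t + (p * ny)%:~R * (2 * pi) by ring.
  have -> : ny%:R * (s + p%:~R * (2 * pi)) - nx%:R * t =
    ny%:R * s - nx%:R * t + (p * ny)%:~R * (2 * pi) by ring.
  rewrite !mobiusD2piz; congr pair; last by congr cos; ring.
  by rewrite -[LHS](cosD2piz p); congr cos; field.
have P2 s t (p : int) : P s t -> P s (t + p%:~R * (2 * pi)).
  rewrite /P cosD2piz => ->; rewrite /billiard_map /=.
  have -> : ny%:R * s + nx%:R * (t + p%:~R * (2 * pi)) =
    ny%:R * s + nx%:R * t + (p * nx)%:~R * (2 * pi) by ring.
  have -> : ny%:R * s - nx%:R * (t + p%:~R * (2 * pi)) =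
    ny%:R * s - nx%:R * t + (- (p * nx%:Z))%:~R * (2 * pi) by ring.
  rewrite !mobiusD2piz; congr pair; first by congr cos; ring.
  by rewrite -[LHS](cosD2piz p); congr cos; field.
have N1 s t : P s t -> P (- s) t.
  rewrite /P cosN => ->; rewrite /billiard_map /=.
  have -> : ny%:R * - s + nx%:R * t = - (ny%:R * s - nx%:R * t) by ring.
  have -> : ny%:R * - s - nx%:R * t = - (ny%:R * s + nx%:R * t) by ring.
  rewrite !mobiusN; congr pair; last by congr cos; ring.
  by rewrite -[LHS]cosN; congr cos; ring.
have N2 s t : P s t -> P s (- t).
  rewrite /P cosN => ->; rewrite /billiard_map /=.
  have -> : ny%:R * s + nx%:R * - t = (ny%:R * s - nx%:R * t) by ring.
  have -> : ny%:R * s - nx%:R * - t = (ny%:R * s + nx%:R * t) by ring.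
  congr pair; first by congr cos; ring.
  by rewrite -[LHS]cosN; congr cos; ring.
have P0 s t : 0 <= s <= pi -> 0 <= t <= pi -> P s t.
  move=> s0 t0; rewrite /P /plane_map /= !xacos_cos //.
  by have [h1 h2] := @billiard_map_square r (s, t) r1 s0 t0; rewrite !xcos_id.
rewrite -/(P t1 t2).
have [s s0 [p Hp]] := foldE t1; have [t t0 [q Hq]] := foldE t2.
have Pst := P0 _ _ s0 t0.
case: Hp => ->; case: Hq => ->.
- exact (P1 _ _ p (P2 _ _ q Pst)).
- exact (P1 _ _ p (P2 _ _ q (N2 _ _ Pst))).
- exact (P1 _ _ p (P2 _ _ q (N1 _ _ Pst))).
- exact (P1 _ _ p (P2 _ _ q (N1 _ _ (N2 _ _ Pst)))).
Qed.

(** Along the curve one linear form is [2 * N * t + psi1] and the other is constantly [- psi1],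
    which is sent to [- psi2]; [tau] is the new time read off the first form. At the listed times
    the first form is [psi1] or [- psi1] modulo 2 pi, so [tau] is explicit there. *)
Lemma planar_deformation (psi1 psi2 : R) : 0 < psi1 < pi -> 0 < psi2 < pi ->
  let N := nx%:R * ny%:R : R in
  exists h g (tau : R -> R), [/\ continuous h, continuous g, cancel h g & cancel g h] /\
    [/\ continuous tau, forall t, exists s, tau s = t,
        forall (p : int) t, tau (t + p%:~R * (2 * pi)) = tau t + p%:~R * (2 * pi) &
        forall t, h (cos (nx%:R * t), cos (ny%:R * t + psi1 / nx%:R)) =
          (cos (nx%:R * tau t), cos (ny%:R * tau t + psi2 / nx%:R))] /\
    forall j : int, tau (j%:~R * pi / N) = j%:~R * pi / N /\
      tau ((j%:~R * pi - psi1) / N) = (j%:~R * pi - psi2) / N.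
Proof.
move=> p1 p2 N; have [r r1 mr] := mobius_transitive p1 p2.
have rN : -1 < - r < 1 by lra.
have mrN : mobius (- r) psi2 = psi1 by rewrite -mr mobiusK.
have mK' : cancel (mobius (- r)) (mobius r).
  by move=> x; have := mobiusK rN x; rewrite opprK.
have N0 : N != 0 by rewrite mulf_neq0.
exists (plane_map r), (plane_map (- r)), (fun t =>
  (mobius r (2 * N * t + psi1) - psi2) / (2 * N)).
have cm := mobius_cts r1.
split; first split; [exact: plane_map_cts|exact: plane_map_cts|exact: plane_mapK| |].
  by move=> x; have := plane_mapK rN x; rewrite opprK.
split; first split.
- by cts.
- move=> t; exists ((mobius (- r) (2 * N * t + psi2) - psi1) / (2 * N)).
  have -> : 2 * N * ((mobius (- r) (2 * N * t + psi2) - psi1) / (2 * N)) + psi1 =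
    mobius (- r) (2 * N * t + psi2) by field.
  by rewrite mK'; field.
- move=> p t.
  have -> : 2 * N * (t + p%:~R * (2 * pi)) + psi1 =
    2 * N * t + psi1 + (2 * nx%:Z * ny%:Z * p)%:~R * (2 * pi) by rewrite /N; ring.
  by rewrite mobiusD2piz /N; field; rewrite nxR nyR.
- move=> t; rewrite plane_map_cos // /billiard_map /=.
  have -> : ny%:R * (nx%:R * t) + nx%:R * (ny%:R * t + psi1 / nx%:R) = 2 * N * t + psi1.
    by rewrite /N; field.
  have -> : ny%:R * (nx%:R * t) - nx%:R * (ny%:R * t + psi1 / nx%:R) = - psi1.
    by field.
  by rewrite mobiusN mr; congr (cos _, cos _); rewrite /N; field; rewrite nxR nyR.
move=> j; split.
  have -> : 2 * N * (j%:~R * pi / N) + psi1 = psi1 + j%:~R * (2 * pi) by field.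
  by rewrite mobiusD2piz mr; field.
have -> : 2 * N * ((j%:~R * pi - psi1) / N) + psi1 = - psi1 + j%:~R * (2 * pi) by field.
by rewrite mobiusD2piz mobiusN mr; field.
Qed.

End PlanarDeformation.

(** * Crossings of the planar Lissajous figure *)

Section Crossings.
Variable R : realType.
Implicit Types s t x y : R.

(** Up to whole turns, [u1] and [u2] lie between the same two consecutive multiples of pi / n, and
    as a function of u the sine vanishes only at such multiples. *)
Lemma sin_same_sign (n : nat) (A1 A2 q j : int) (u1 u2 : R) : (0 < n)%N ->
  A1%:~R * pi < n%:R * u1 < (A1 + 1)%:~R * pi ->
  A2%:~R * pi < n%:R * u2 < (A2 + 1)%:~R * pi ->
  A2 = A1 + 2 * n%:Z * q ->
  0 < sin (j%:~R * pi / n%:R + u1) * sin (j%:~R * pi / n%:R + u2).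
Proof.
move=> n0 H1 H2 AA; pose w2 := u2 + (- q)%:~R * (2 * pi).
have nR : 0 < n%:R :> R by rewrite ltr0n.
have nR0 : n%:R != 0 :> R by rewrite gt_eqF.
have H3 : A1%:~R * pi < n%:R * w2 < (A1 + 1)%:~R * pi.
  have -> : n%:R * w2 = n%:R * u2 - (2 * n%:Z * q)%:~R * pi by rewrite /w2; ring.
  move: H2; rewrite AA; set z := 2 * n%:Z * q => H2.
  by rewrite !rmorphD /= in H2 *; lra.
have -> : sin (j%:~R * pi / n%:R + u2) = sin (j%:~R * pi / n%:R + w2).
  by rewrite /w2 addrA sinD2piz.
have nz0 : n%:Z != 0 by rewrite eqz_nat -lt0n.
have nzp : 0 < n%:Z by rewrite ltz_nat.
have [p [r [jE r0 rn]]] : exists p r : int,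
    [/\ j + A1 = p * n%:Z + r, 0 <= r & r + 1 <= n%:Z].
  exists ((j + A1) %/ n%:Z)%Z, ((j + A1) %% n%:Z)%Z.
  by split; [exact: divz_eq|exact: modz_ge0|rewrite lezD1; exact: ltz_pmod].
have r0R : 0 <= r%:~R :> R by rewrite ler0z.
have rnR : r%:~R + 1 <= n%:R :> R
  by rewrite -[1]/(1%:~R) -intrD -[n%:R]/(n%:~R) ler_int.
have pos (u : R) : A1%:~R * pi < n%:R * u < (A1 + 1)%:~R * pi ->
    0 < sin (j%:~R * pi / n%:R + u + (- p)%:~R * pi).
  move=> Hu; apply: sin_gt0_pi.
  have -> : j%:~R * pi / n%:R + u + (- p)%:~R * pi =
    (n%:R * u - A1%:~R * pi + ((j + A1)%:~R - p%:~R * n%:R) * pi) / n%:R.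
    field.
    by rewrite pnatr_eq0 -lt0n.
  rewrite jE; have -> : (p * n%:Z + r)%:~R - p%:~R * n%:R = r%:~R :> R by ring.
  have pi0 := pi_gt0 R.
  rewrite ltr_pdivlMr // ltr_pdivrMr // mul0r.
  rewrite rmorphD /= in Hu; apply/andP; split; nra.
have [e e1 He] := @sin_cosDpiz R (- p).
have := mulr_gt0 (pos _ H1) (pos _ H3).
by rewrite (He _).1 (He _).1 mulrACA e1 mul1r.
Qed.

Definition congr2pi x y := exists p : int, x = y + p%:~R * (2 * pi).

Definition sgb (b : bool) : R := if b then -1 else 1.

Lemma sgbM (b c : bool) : sgb b * sgb c = sgb (b (+) c).
Proof. by rewrite /sgb; case: b c => [] [] /=; ring. Qed.

Lemma congr2pi_sg_trans (b c : bool) x y z :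
  congr2pi x (sgb b * y) -> congr2pi y (sgb c * z) ->
  congr2pi x (sgb (b (+) c) * z).
Proof.
move=> [p ->] [q ->]; rewrite -sgbM.
case: b; [exists (p - q)|exists (p + q)]; rewrite /sgb; ring.
Qed.

Variables (nx ny : nat) (psi : R).
Hypotheses (nx0 : (0 < nx)%N) (ny0 : (0 < ny)%N) (nxy : coprime nx ny).
Hypothesis psi_pi : 0 < psi < pi.

Let nxR : nx%:R != 0 :> R. Proof. by rewrite pnatr_eq0 -lt0n. Qed.
Let nyR : ny%:R != 0 :> R. Proof. by rewrite pnatr_eq0 -lt0n. Qed.
Let N : R := nx%:R * ny%:R.

Definition plane_curve t : R * R :=
  (cos (nx%:R * t), cos (ny%:R * t + psi / nx%:R)).

Lemma plane_curve_cts : continuous plane_curve.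
Proof. by rewrite /plane_curve; cts. Qed.

Lemma plane_curve_period (p : int) t :
  plane_curve (t + p%:~R * (2 * pi)) = plane_curve t.
Proof.
rewrite /plane_curve; congr pair.
  by rewrite -(cosD2piz (p * nx%:Z) (nx%:R * t)); congr cos; ring.
by rewrite -(cosD2piz (p * ny%:Z) (ny%:R * t + _)); congr cos; ring.
Qed.

(** The Booleans tell which coordinate angles change sign from [t] to [s]. They compose by exclusive
    or; the two mixed cases are the two kinds of crossings. *)
Definition strands (b c : bool) s t :=
  congr2pi (nx%:R * s) (sgb b * (nx%:R * t)) /\
  congr2pi (ny%:R * s + psi / nx%:R) (sgb c * (ny%:R * t + psi / nx%:R)).

Lemma strandsP s t : plane_curve s = plane_curve t -> exists b c, strands b c s t.
Proof.
move=> [/cos_eqP[p Hp] /cos_eqP[q Hq]].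
case: Hp => Hp; case: Hq => Hq;
  [exists false, false|exists false, true|exists true, false|exists true, true];
  by split; [exists p|exists q]; rewrite /sgb ?mul1r ?mulN1r.
Qed.

Lemma strands_trans b c b' c' s t r :
  strands b c s t -> strands b' c' t r -> strands (b (+) b') (c (+) c') s r.
Proof.
by move=> [h1 h2] [h3 h4]; split;
  [exact: congr2pi_sg_trans h1 h3|exact: congr2pi_sg_trans h2 h4].
Qed.

Lemma strands_ff s t : strands false false s t -> congr2pi s t.
Proof.
move=> [[p Hp] [q Hq]]; rewrite /sgb !mul1r in Hp Hq.
have [r Hr] : exists r : int, s - t = r%:~R * (2 * pi).
  apply: (@coprime_2piz R nx ny (s - t) p q) => //; first by rewrite mulrBr Hp; ring.
  by rewrite mulrBr; apply: (addIr (psi / nx%:R)); rewrite addrAC Hq; ring.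
by exists r; rewrite -Hr; ring.
Qed.

(** Eliminating [s] and [t] would make psi an integer multiple of pi. *)
Lemma strands_tt s t : ~ strands true true s t.
Proof.
move=> [[p Hp] [q Hq]]; rewrite /sgb !mulN1r in Hp Hq.
have E : 2 * psi = (q * nx%:Z - p * ny%:Z)%:~R * (2 * pi).
  have E1 : nx%:R * (ny%:R * s + psi / nx%:R) - ny%:R * (nx%:R * s) = psi by field.
  rewrite Hq Hp in E1.
  have -> : 2 * psi = psi + psi by ring.
  by rewrite -{1}E1; field.
have pi0 := pi_gt0 R.
have {}E : psi = (q * nx%:Z - p * ny%:Z)%:~R * pi by lra.
move: (q * nx%:Z - p * ny%:Z) E => z E.
have z0 : 0 < z by rewrite -(ltr0z R) -(pmulr_lgt0 _ pi0) -E; case/andP: psi_pi.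
have : z%:~R < 1 :> R by rewrite -(ltr_pM2r pi0) -E mul1r; case/andP: psi_pi.
by rewrite -[1]/(1%:~R) ltr_int; lia.
Qed.

Lemma strands_ft s t : strands false true s t -> exists k l : int,
  s = ((l * nx%:Z + k * ny%:Z)%:~R * pi - psi) / N /\
  t = ((l * nx%:Z - k * ny%:Z)%:~R * pi - psi) / N.
Proof.
move=> [[p Hp] [q Hq]]; rewrite /sgb mul1r mulN1r in Hp Hq; exists p, q.
have sE : s = t + p%:~R * (2 * pi) / nx%:R.
  by apply: (mulfI nxR); rewrite Hp; field.
have tE : t = ((q * nx%:Z - p * ny%:Z)%:~R * pi - psi) / N.
  apply: (mulfI nyR); rewrite sE in Hq; rewrite /N.
  have {}Hq : 2 * (ny%:R * t) =
    q%:~R * (2 * pi) - 2 * psi / nx%:R - ny%:R * (p%:~R * (2 * pi) / nx%:R).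
    have := Hq; set w := ny%:R * t => H.
    have {}H : w + ny%:R * (p%:~R * (2 * pi) / nx%:R) + psi / nx%:R =
      - (w + psi / nx%:R) + q%:~R * (2 * pi).
      by rewrite -H /w; ring.
    by lra.
  have -> : ny%:R * t = 2 * (ny%:R * t) / 2 by field.
  by rewrite Hq; field; rewrite nxR nyR.
by split => //; rewrite sE tE /N; field; rewrite nxR nyR.
Qed.

Lemma strands_tf s t : strands true false s t -> exists k l : int,
  s = (l * ny%:Z + k * nx%:Z)%:~R * pi / N /\
  t = (l * ny%:Z - k * nx%:Z)%:~R * pi / N.
Proof.
move=> [[p Hp] [q Hq]]; rewrite /sgb mul1r mulN1r in Hp Hq; exists q, p.
have sE : s = t + q%:~R * (2 * pi) / ny%:R.
  by apply: (mulfI nyR); apply: (addIr (psi / nx%:R)); rewrite Hq; field;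
    rewrite nxR nyR.
have tE : t = (p * ny%:Z - q * nx%:Z)%:~R * pi / N.
  apply: (mulfI nxR); rewrite sE in Hp; rewrite /N.
  have {}Hp : 2 * (nx%:R * t) = p%:~R * (2 * pi) - nx%:R * (q%:~R * (2 * pi) / ny%:R).
    by rewrite mulrDr in Hp; lra.
  have -> : nx%:R * t = 2 * (nx%:R * t) / 2 by field.
  by rewrite Hp; field; rewrite nxR nyR.
by split => //; rewrite sE tE /N; field; rewrite nxR nyR.
Qed.

(** Two nontrivial types that are not [true true] either agree, and then compose to the trivial one,
    or differ, and then compose to the excluded [true true]. *)
Lemma plane_curve_double s0 t0 s : plane_curve s0 = plane_curve t0 ->
  ~ congr2pi s0 t0 -> plane_curve s = plane_curve s0 ->
  congr2pi s s0 \/ congr2pi s t0.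
Proof.
move=> /strandsP[b [c st]] nst /strandsP[b' [c' st']].
have := strands_trans st' st.
case: b c b' c' st st' => [] [] [] [] /= st st' st2;
  try (by case: (strands_tt st)); try (by case: (strands_tt st'));
  try (by case: (strands_tt st2)); try (by case: nst; exact: strands_ff st);
  try (by left; exact: strands_ff st'); by right; exact: strands_ff st2.
Qed.

(** The indices cover one period of the candidate times of both kinds; some simple points, such as
    turning points, may be listed too. *)
Definition crossings : seq (R * R) :=
  [seq plane_curve ((i%:R : R) * pi / N) | i <- iota 0 (2 * nx * ny)] ++
  [seq plane_curve (((i%:R : R) * pi - psi) / N) | i <- iota 0 (2 * nx * ny)].

Lemma mem_crossings (j : int) :
  plane_curve (j%:~R * pi / N) \in crossings /\
  plane_curve ((j%:~R * pi - psi) / N) \in crossings.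
Proof.
pose M := (2 * nx * ny)%N.
have M0 : (0 < M)%N by rewrite !muln_gt0 nx0 ny0.
have Mz : M%:Z != 0 by rewrite eqz_nat -lt0n.
have [i iM ->] : exists2 i : nat, (i < M)%N & j = (j %/ M%:Z)%Z * M%:Z + i%:Z.
  have r0 := modz_ge0 j Mz.
  exists `|(j %% M%:Z)%Z|%N; last by rewrite gez0_abs // -divz_eq.
  by rewrite -ltz_nat gez0_abs // ltz_pmod // ltz_nat.
move: (j %/ M%:Z)%Z => d; rewrite !mem_cat; split; apply/orP; [left|right];
  apply/mapP; exists i; rewrite ?mem_iota //.
  by rewrite -[RHS](plane_curve_period d); congr plane_curve; rewrite /M /N; field;
    rewrite nxR nyR.
by rewrite -[RHS](plane_curve_period d); congr plane_curve; rewrite /M /N; field;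
  rewrite nxR nyR.
Qed.

End Crossings.

(** * Lissajous curves and their symmetries *)

Section LissajousSymmetries.
Variables (R : realType) (nx ny nz : nat).
Implicit Types px py pz s t : R.

Lemma lissajous_period px py pz (p : int) t :
  lissajous nx ny nz px py pz (t + p%:~R * (2 * pi)) = lissajous nx ny nz px py pz t.
Proof.
have P (n : nat) (a : R) : cos (n%:R * (t + p%:~R * (2 * pi)) + a) = cos (n%:R * t + a).
  by rewrite -(cosD2piz (p * n%:Z) (n%:R * t + a)); congr cos; ring.
by rewrite /lissajous !P.
Qed.

Lemma reduce_2pi t : exists p : int, 0 <= t + p%:~R * (2 * pi) < 2 * pi.
Proof.
have [p /andP[pt tp]] := floor_pi (t / 2); exists (- p).
by rewrite rmorphD /= in tp; rewrite rmorphN /=; lra.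
Qed.

Lemma lissajous_knotE px py pz :
  lissajous_knot nx ny nz px py pz = range (lissajous nx ny nz px py pz).
Proof.
apply/seteqP; split => [_ [t _ <-]|_ [t _ <-]]; first by exists t.
have [p /andP[p0 p1]] := reduce_2pi t.
exists (t + p%:~R * (2 * pi)); last by rewrite lissajous_period.
by rewrite /= in_itv /= p0 ltW.
Qed.

Lemma lissajous_embedded_2pi px py pz : lissajous_embedded nx ny nz px py pz ->
  forall s t, cos (nx%:R * s + px) = cos (nx%:R * t + px) ->
    cos (ny%:R * s + py) = cos (ny%:R * t + py) ->
    cos (nz%:R * s + pz) = cos (nz%:R * t + pz) -> congr2pi s t.
Proof.
move=> emb s t ex ey ez.
have [p ps] := reduce_2pi s; have [q qt] := reduce_2pi t.
have := emb _ _ ps qt; rewrite !lissajous_period => /(_ _) H.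
have {}H : s + p%:~R * (2 * pi) = t + q%:~R * (2 * pi).
  by apply: H; rewrite /lissajous ex ey ez.
exists (q - p); have -> : s = s + p%:~R * (2 * pi) - p%:~R * (2 * pi) by ring.
by rewrite H; ring.
Qed.

(** Translating time by [c] gives the terms in [c]; each multiple of pi is a possible reflection of
    one coordinate. *)
Lemma lissajous_equiv_shift px py pz (c : R) (k l m : int) :
  knot_equiv (range (lissajous nx ny nz px py pz))
    (range (lissajous nx ny nz (px + nx%:R * c + k%:~R * pi)
       (py + ny%:R * c + l%:~R * pi) (pz + nz%:R * c + m%:~R * pi))).
Proof.
have [e1 ee1 H1] := @sin_cosDpiz R k; have [e2 ee2 H2] := @sin_cosDpiz R l.
have [e3 ee3 H3] := @sin_cosDpiz R m.
pose h (p : point3 R) : point3 R := (e1 * p.1.1, e2 * p.1.2, e3 * p.2).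
have hK : cancel h h by move=> [[x y] z]; rewrite /h /= !mulrA ee1 ee2 ee3 !mul1r.
have ch : continuous h by rewrite /h; cts.
apply: (@knot_equiv_range _ _ _ h (fun t => t - c)).
- by split => //; exists h.
- by move=> t; exists (t + c); rewrite addrK.
have E (n : nat) (a : R) (j : int) (t : R) :
    n%:R * (t - c) + (a + n%:R * c + j%:~R * pi) = n%:R * t + a + j%:~R * pi.
  by ring.
by move=> t; rewrite /h /lissajous /= !E (H1 _).2 (H2 _).2 (H3 _).2.
Qed.

Lemma lissajous_range_opp px py pz :
  range (lissajous nx ny nz (- px) (- py) (- pz)) = range (lissajous nx ny nz px py pz).
Proof.
have E (n : nat) (a t : R) : cos (n%:R * - t + - a) = cos (n%:R * t + a).
  by rewrite -[RHS]cosN; congr cos; ring.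
have E' (n : nat) (a t : R) : cos (n%:R * t + - a) = cos (n%:R * - t + a).
  by rewrite -[RHS]cosN; congr cos; ring.
apply/seteqP; split => _ [t _ <-]; exists (- t) => //; rewrite /lissajous.
  by rewrite !E'.
by rewrite !E.
Qed.

End LissajousSymmetries.

(* At a time where both phases are multiples of pi the two coordinates are
   symmetric, and the third one coincides at the two times at distance pi / r. *)
Lemma phases_not_piz (R : realType) (m n r : nat) (a b c : R) (j : int) :
  (0 < m)%N -> (1 < r)%N -> coprime m n ->
  (forall s t : R, cos (m%:R * s + a) = cos (m%:R * t + a) ->
    cos (n%:R * s + b) = cos (n%:R * t + b) ->
    cos (r%:R * s + c) = cos (r%:R * t + c) -> congr2pi s t) ->
  m%:R * b - n%:R * a <> j%:~R * pi.
Proof.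
move=> m0 r1 mn inj /(coprime_phases m0 mn)[d [k [l [Hk Hl]]]].
have rR : r%:R != 0 :> R by rewrite pnatr_eq0; lia.
have sym (i : nat) (w : R) (q : int) : i%:R * d + w = q%:~R * pi ->
    cos (i%:R * (d + pi / r%:R) + w) = cos (i%:R * (d - pi / r%:R) + w).
  move=> H; have [e _ He] := @sin_cosDpiz R q.
  have -> : i%:R * (d + pi / r%:R) + w = i%:R * (pi / r%:R) + (i%:R * d + w) by ring.
  have -> : i%:R * (d - pi / r%:R) + w =
    - (i%:R * (pi / r%:R)) + (i%:R * d + w) by ring.
  by rewrite H (He _).2 (He _).2 cosN.
have [//||//|p Hp] := inj (d + pi / r%:R) (d - pi / r%:R).
- exact: sym Hk.
- exact: sym Hl.
- rewrite -(cosD2piz 1 (r%:R * (d - pi / r%:R) + c)); congr cos; by field.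
have pi0 := pi_gt0 R.
have {}Hp : 2 * pi / r%:R = p%:~R * (2 * pi) :> R.
  have -> : 2 * pi / r%:R = (d + pi / r%:R) - (d - pi / r%:R) by field.
  by rewrite Hp; ring.
have : (p * r%:Z)%:~R = 1 :> R.
  have pi2 : 2 * pi != 0 :> R by rewrite mulf_neq0 ?pnatr_eq0 // gt_eqF.
  apply: (mulIf pi2); rewrite mul1r.
  have -> : (p * r%:Z)%:~R * (2 * pi) = p%:~R * (2 * pi) * r%:R :> R by ring.
  by rewrite -Hp; field.
rewrite -[1]/(1%:~R) => /intr_inj pr1.
have [p0|p0] := leP p 0; nia.
Qed.

(** * Classification by crossing data *)

Section CrossingData.
Variables (R : realType) (nx ny nz : nat).
Hypotheses (nx0 : (0 < nx)%N) (ny0 : (0 < ny)%N) (nxy : coprime nx ny).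

Let nxR : nx%:R != 0 :> R. Proof. by rewrite pnatr_eq0 -lt0n. Qed.
Let nyR : ny%:R != 0 :> R. Proof. by rewrite pnatr_eq0 -lt0n. Qed.

(** By [subr_cos] both sides are height differences at a crossing; [C] is the factor common to the
    two knots, and the ratio becomes the slope over that crossing. *)
Lemma sin_ratio_gt0 (S1 S2 C : R) : 0 < S1 * S2 ->
  exists2 v, 0 < v & - 2 * S2 * C = v * (- 2 * S1 * C).
Proof.
move=> S12; have S10 : S1 != 0 by apply/eqP => S0; move: S12; rewrite S0 mul0r ltxx.
exists (S2 / S1); last by field.
have -> : S2 / S1 = S1 * S2 / S1 ^+ 2 by field.
by rewrite divr_gt0 // exprn_even_gt0.
Qed.

Lemma same_data_equiv (psi1 psi2 u1 u2 : R) (A1 A2 B1 B2 q q' : int) :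
  0 < psi1 < pi -> 0 < psi2 < pi ->
  A1%:~R * pi < nx%:R * u1 < (A1 + 1)%:~R * pi ->
  A2%:~R * pi < nx%:R * u2 < (A2 + 1)%:~R * pi ->
  B1%:~R * pi < ny%:R * (u1 - nz%:R * psi1 / (nx%:R * ny%:R)) < (B1 + 1)%:~R * pi ->
  B2%:~R * pi < ny%:R * (u2 - nz%:R * psi2 / (nx%:R * ny%:R)) < (B2 + 1)%:~R * pi ->
  A2 = A1 + 2 * nx%:Z * q -> B2 = B1 + 2 * ny%:Z * q' ->
  knot_equiv (range (lissajous nx ny nz 0 (psi1 / nx%:R) u1))
             (range (lissajous nx ny nz 0 (psi2 / nx%:R) u2)).
Proof.
move=> hpsi1 hpsi2 hA1 hA2 hB1 hB2 AA BB.
have [h [g [tau [[ch cg hg gh] [[ctau stau ptau htau] tauE]]]]] :=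
  planar_deformation nx0 ny0 hpsi1 hpsi2.
pose ga := plane_curve nx ny psi1.
(* [z2] is the height of the second knot, pulled back along [tau] to live over the first plane
   curve. *)
pose z1 (t : R) := cos (nz%:R * t + u1); pose z2 (t : R) := cos (nz%:R * tau t + u2).
have pz1 (p : int) t : z1 (t + p%:~R * (2 * pi)) = z1 t.
  by rewrite /z1 -(cosD2piz (p * nz%:Z) (nz%:R * t + u1)); congr cos; ring.
have pz2 (p : int) t : z2 (t + p%:~R * (2 * pi)) = z2 t.
  by rewrite /z2 ptau -(cosD2piz (p * nz%:Z) (nz%:R * tau t + u2)); congr cos; ring.
have zc s t : congr2pi s t -> z1 s = z1 t /\ z2 s = z2 t by move=> [p ->];
  rewrite pz1 pz2.
(* [tau] moves both strands of a crossing by the same amount, so the two height differences share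
   the factor [sin (nz (s - t) / 2)], and [sin_same_sign] compares the remaining sines. *)
have ratio s t : ga s = ga t -> ~ congr2pi s t ->
    exists2 v, 0 < v & z2 s - z2 t = v * (z1 s - z1 t).
  move=> /strandsP[b [c st]] nst; rewrite /z1 /z2 !subr_cos.
  case: b c st => [] [] st.
  - by case: (strands_tt nx0 ny0 nxy hpsi1 st).
  - have [k [l [sE tE]]] := strands_tf nx0 ny0 st.
    have ts : tau s = s by rewrite sE (tauE _).1.
    have tt : tau t = t by rewrite tE (tauE _).1.
    rewrite ts tt.
    have E u : (nz%:R * s + u + (nz%:R * t + u)) / 2 = (nz%:Z * l)%:~R * pi / nx%:R + u.
      by rewrite sE tE; field; rewrite nxR nyR.
    have E' u : nz%:R * s + u - (nz%:R * t + u) = nz%:R * (s - t) by ring.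
    by rewrite !E !E'; apply: sin_ratio_gt0; exact: sin_same_sign nx0 hA1 hA2 AA.
  - have [k [l [sE tE]]] := strands_ft nx0 ny0 st.
    have ts : tau s = s + (psi1 - psi2) / (nx%:R * ny%:R).
      by rewrite sE (tauE _).2; field; rewrite nxR nyR.
    have tt : tau t = t + (psi1 - psi2) / (nx%:R * ny%:R).
      by rewrite tE (tauE _).2; field; rewrite nxR nyR.
    have E1 : (nz%:R * s + u1 + (nz%:R * t + u1)) / 2 =
        (nz%:Z * l)%:~R * pi / ny%:R + (u1 - nz%:R * psi1 / (nx%:R * ny%:R)).
      by rewrite sE tE; field; rewrite nxR nyR.
    have E2 : (nz%:R * tau s + u2 + (nz%:R * tau t + u2)) / 2 =
        (nz%:Z * l)%:~R * pi / ny%:R + (u2 - nz%:R * psi2 / (nx%:R * ny%:R)).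
      by rewrite ts tt sE tE; field; rewrite nxR nyR.
    have E3 : nz%:R * s + u1 - (nz%:R * t + u1) = nz%:R * (s - t) by ring.
    have E4 : nz%:R * tau s + u2 - (nz%:R * tau t + u2) = nz%:R * (s - t).
      by rewrite ts tt; ring.
    by rewrite E1 E2 E3 E4; apply: sin_ratio_gt0; exact: sin_same_sign ny0 hB1 hB2 BB.
  - by case: nst; exact: (strands_ff nxy st).
have [h1 hh1 h1E] : exists2 h1, homeo3 h1 & forall t, h1 (ga t, z1 t) = (ga t, z2 t).
  apply: (@fiberwise_equiv R ga z1 z2 (crossings nx ny psi1)) => //.
  - exact: plane_curve_cts.
  - by rewrite /z1; cts.
  - by rewrite /z2; cts.
  - by move=> p t; exact: plane_curve_period.
  - move=> s t /strandsP[b [c st]] sP; apply: zc.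
    case: b c st => [] [] st.
    + by case: (strands_tt nx0 ny0 nxy hpsi1 st).
    + have [k [l [sE _]]] := strands_tf nx0 ny0 st.
      by move: sP; rewrite sE /ga (mem_crossings psi1 nx0 ny0 _).1.
    + have [k [l [sE _]]] := strands_ft nx0 ny0 st.
      by move: sP; rewrite sE /ga (mem_crossings psi1 nx0 ny0 _).2.
    + exact: (strands_ff nxy st).
  - move=> x.
    (* At a simple point any slope works; at a double point every time is congruent to [s0] or [t0],
       so a single ratio serves all pairs. *)
    have [[s0 [t0 [xs xt nst]]]|no] :=
        pselect (exists s0 t0, [/\ ga s0 = x, ga t0 = x & ~ congr2pi s0 t0]);
          last first.
      exists 1 => // s t sx tx; have [/zc[-> ->]|nst] := pselect (congr2pi s t);
        first by ring.
      by case: no; exists s, t.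
    have st0 : ga s0 = ga t0 by rewrite xs xt.
    have [v v0 vE] := ratio _ _ st0 nst; exists v => // s t sx tx.
    have dbl r : ga r = x -> (z1 r = z1 s0 /\ z2 r = z2 s0) \/ (z1 r =
      z1 t0 /\ z2 r = z2 t0).
      move=> rx; have rs0 : ga r = ga s0 by rewrite rx xs.
      by have [/zc|/zc] := plane_curve_double nx0 ny0 nxy hpsi1 st0 nst rs0;
        [left|right].
    case: (dbl s sx) => [] [-> ->]; case: (dbl t tx) => [] [-> ->] //; [ring| |ring].
    by rewrite -opprB vE; ring.
apply: (@knot_equiv_trans _ (range (fun t => (ga t, z2 t)))).
  apply: (@knot_equiv_range _ _ _ h1 id) => //; first by move=> t; exists t.
  by move=> t; rewrite -h1E /lissajous addr0.
apply: (@knot_equiv_range _ _ _ (fun p => (h p.1, p.2)) tau) => //.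
  exact: prod_homeo ch cg hg gh.
by move=> t; rewrite /= htau /lissajous addr0.
Qed.

(** The phases are normalised to (0, psi / nx, u). Crossings of the second kind occur at times
    offset by - psi / (nx ny), which explains the corrected phase in the bounds for [B]. Strict
    bounds keep the sines at crossings nonzero. *)
Definition has_data (K : set (point3 R)) (A B : int) := exists psi u : R,
  [/\ 0 < psi < pi, A%:~R * pi < nx%:R * u < (A + 1)%:~R * pi,
      B%:~R * pi < ny%:R * (u - nz%:R * psi / (nx%:R * ny%:R)) < (B + 1)%:~R * pi &
      knot_equiv K (range (lissajous nx ny nz 0 (psi / nx%:R) u))].

Lemma has_data_equiv K1 K2 (A1 A2 B1 B2 q q' : int) :
  has_data K1 A1 B1 -> has_data K2 A2 B2 ->
  A2 = A1 + 2 * nx%:Z * q -> B2 = B1 + 2 * ny%:Z * q' -> knot_equiv K1 K2.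
Proof.
move=> [psi1 [u1 [h1 a1 b1 k1]]] [psi2 [u2 [h2 a2 b2 k2]]] AA BB.
apply: (knot_equiv_trans k1); apply: (knot_equiv_trans _ (knot_equiv_sym k2)).
exact: same_data_equiv AA BB.
Qed.

Lemma has_data_mirror K (A B m : int) : has_data K A B ->
  has_data K (A + nx%:Z * m) (B + ny%:Z * m).
Proof.
move=> [psi [u [hpsi a b k]]]; exists psi, (u + m%:~R * pi); split => //.
- have -> : nx%:R * (u + m%:~R * pi) = nx%:R * u + (nx%:Z * m)%:~R * pi by ring.
  by move: a; move: (nx%:Z * m) => z; rewrite !rmorphD /=; lra.
- have -> : ny%:R * (u + m%:~R * pi - nz%:R * psi / (nx%:R * ny%:R)) =
    ny%:R * (u - nz%:R * psi / (nx%:R * ny%:R)) + (ny%:Z * m)%:~R * pi by ring.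
  by move: b; move: (ny%:Z * m) => z; rewrite !rmorphD /=; lra.
- apply: (knot_equiv_trans k).
  have := lissajous_equiv_shift nx ny nz 0 (psi / nx%:R) u 0 0 0 m.
  by rewrite !mulr0 !mul0r !addr0.
Qed.

(** Reversing time negates the phases; a shift by k pi / nx and reflections restore the normal form
    with [pi - psi], thanks to the Bezout relation. The terms -1 come from floor (- x) = - 1 - floor
    x for non-integral x. *)
Lemma has_data_reverse K (A B k k' : int) : k * ny%:Z - k' * nx%:Z = 1 ->
  has_data K A B -> has_data K (nz%:Z * k - 1 - A) (nz%:Z * k' - 1 - B).
Proof.
move=> kk [psi [u [hpsi a b K1]]].
have kkR : k%:~R * ny%:R = 1 + k'%:~R * nx%:R :> R.
  have E : k%:~R * ny%:R - k'%:~R * nx%:R = 1 :> R.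
    by rewrite -[RHS]/(1%:~R) -kk; ring.
  by lra.
exists (pi - psi), (- u + nz%:R * (k%:~R * pi / nx%:R)); split.
- lra.
- have -> : nx%:R * (- u + nz%:R * (k%:~R * pi / nx%:R)) =
    - (nx%:R * u) + (nz%:Z * k)%:~R * pi by field.
  by move: a; move: (nz%:Z * k) => z; rewrite !rmorphD !rmorphN /=; lra.
- have -> : ny%:R * (- u + nz%:R * (k%:~R * pi / nx%:R) -
      nz%:R * (pi - psi) / (nx%:R * ny%:R)) =
    - (ny%:R * (u - nz%:R * psi / (nx%:R * ny%:R))) +
      nz%:R * (k%:~R * ny%:R - 1) * pi / nx%:R by field; rewrite nxR nyR.
  have -> : nz%:R * (k%:~R * ny%:R - 1) * pi / nx%:R = (nz%:Z * k')%:~R * pi :> R.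
    by rewrite kkR; field.
  by move: b; move: (nz%:Z * k') => z; rewrite !rmorphD !rmorphN /=; lra.
apply: (knot_equiv_trans K1); rewrite -lissajous_range_opp.
have := lissajous_equiv_shift nx ny nz (- 0) (- (psi / nx%:R)) (- u) (k%:~R * pi /
  nx%:R) (- k) (- k') 0.
have -> : - 0 + nx%:R * (k%:~R * pi / nx%:R) + (- k)%:~R * pi = 0 :> R by field.
have -> : - (psi / nx%:R) + ny%:R * (k%:~R * pi / nx%:R) + (- k')%:~R * pi =
    (k%:~R * ny%:R - k'%:~R * nx%:R) * pi / nx%:R - psi / nx%:R by field.
have -> : (k%:~R * ny%:R - k'%:~R * nx%:R) * pi / nx%:R - psi / nx%:R =
  (pi - psi) / nx%:R.
  by rewrite kkR; field.
by rewrite mul0r addr0.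
Qed.

Lemma floor_pi_strict (x : R) : (forall j : int, x <> j%:~R * pi) ->
  exists p : int, p%:~R * pi < x < (p + 1)%:~R * pi.
Proof.
move=> H; have [p /andP[p1 p2]] := floor_pi x; exists p.
by rewrite p2 andbT lt_neqAle p1 andbT; apply/eqP => /esym/H.
Qed.

Lemma has_data_exists (px py pz : R) :
  (forall j : int, nx%:R * py - ny%:R * px <> j%:~R * pi) ->
  (forall j : int, nx%:R * pz - nz%:R * px <> j%:~R * pi) ->
  (forall j : int, ny%:R * pz - nz%:R * py <> j%:~R * pi) ->
  exists A B, has_data (range (lissajous nx ny nz px py pz)) A B.
Proof.
(* The Bezout decomposition of [p] distributes the p half-turns removed from psi over the x and y
   phases, where they are reflections. *)
move=> /floor_pi_strict[p Hp] n2 n3; have [l [k kl]] := coprime_solve p nxy.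
pose c := - (px + k%:~R * pi) / nx%:R; pose psi := nx%:R * py - ny%:R * px - p%:~R * pi.
pose u := pz + nz%:R * c.
have psiE : py + ny%:R * c + (- l)%:~R * pi = psi / nx%:R.
  by rewrite /c /psi -kl; field.
have [|A HA] := @floor_pi_strict (nx%:R * u).
  move=> j Hj; apply: (n2 (j + nz%:Z * k)).
  by rewrite rmorphD /= mulrDl -Hj /u /c; field.
have [|B HB] := @floor_pi_strict (ny%:R * (u - nz%:R * psi / (nx%:R * ny%:R))).
  move=> j Hj; apply: (n3 (j - nz%:Z * l)).
  rewrite rmorphB /= mulrBl -Hj.
  have -> : nz%:R * psi / (nx%:R * ny%:R) = nz%:R * (psi / nx%:R) / ny%:R by field;
    rewrite nxR nyR.
  by rewrite -psiE /u; field.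
exists A, B, psi, u; split => //.
  by rewrite rmorphD /= in Hp; rewrite /psi; lra.
have := lissajous_equiv_shift nx ny nz px py pz c k (- l) 0.
have -> : px + nx%:R * c + k%:~R * pi = 0 by rewrite /c; field.
by rewrite psiE mul0r addr0.
Qed.

(* The data (A, B) matter only modulo (2 nx, 0), (0, 2 ny) and (nx, ny), that is
   through ny A + nx B modulo 2 nx ny. *)
Lemma has_data_equiv_mod K1 K2 (A1 A2 B1 B2 j : int) :
  has_data K1 A1 B1 -> has_data K2 A2 B2 ->
  ny%:Z * A1 + nx%:Z * B1 = ny%:Z * A2 + nx%:Z * B2 + 2 * nx%:Z * ny%:Z * j ->
  knot_equiv K1 K2.
Proof.
move=> d1 d2 E.
have nxz : nx%:Z != 0 by rewrite eqz_nat -lt0n.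
have nyz : ny%:Z != 0 by rewrite eqz_nat -lt0n.
have /dvdzP[a Ha] : (nx%:Z %| A1 - A2)%Z.
  have cxy : coprimez nx%:Z ny%:Z by [].
  rewrite -(Gauss_dvdzl _ cxy); apply/dvdzP.
  exists (2 * ny%:Z * j - (B1 - B2)); nia.
have Hb : B1 - B2 = ny%:Z * (2 * j - a).
  apply: (mulfI nxz); nia.
(* Shifting the second data by [a] times (nx, ny) makes the first entries equal and leaves a
   multiple of 2 ny between the second ones. *)
apply: (has_data_equiv d1 (has_data_mirror a d2) (q := 0) (q' := a - j)).
  by rewrite mulr0 addr0; nia.
nia.
Qed.

End CrossingData.

(** * Curves with a frequency equal to one *)

Section FrequencyOne.
Variable R : realType.

(** [f] and [g] are the Chebyshev polynomials T_n and U_(n-1). The values of [g] at 1 and -1 are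
    recorded because sin th vanishes there and the identity says nothing about them. *)
Lemma chebyshev (n : nat) : exists f g : R -> R,
  [/\ continuous f, continuous g,
      forall th, cos (n%:R * th) = f (cos th) /\ sin (n%:R * th) = sin th * g (cos th),
      g 1 = n%:R &
      f (-1) * f (-1) = 1 /\ g (-1) = - n%:R * f (-1)].
Proof.
suff [f [g [cf cg E [f1 g1] [fN gN]]]] : exists f g : R -> R,
  [/\ continuous f, continuous g,
      forall th, cos (n%:R * th) = f (cos th) /\ sin (n%:R * th) = sin th * g (cos th),
      f 1 = 1 /\ g 1 = n%:R &
      f (-1) * f (-1) = 1 /\ g (-1) = - n%:R * f (-1)] by exists f, g.
elim: n => [|n [f [g [cf cg E [f1 g1] [fN gN]]]]].
  exists (fun=> 1), (fun=> 0); split; rewrite ?mulr0 ?mulr1 ?oppr0 //;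
    try exact: cts_cst.
  by move=> th; rewrite !mul0r cos0 sin0 mulr0.
exists (fun x => x * f x - (1 - x * x) * g x), (fun x => f x + x * g x); split.
- by cts.
- by cts.
- move=> th; have -> : n.+1%:R * th = th + n%:R * th by ring.
  rewrite cosD sinD (E th).1 (E th).2; split; last by ring.
  have -> : 1 - cos th * cos th = sin th ^+ 2 by rewrite sin2cos2.
  by ring.
- by rewrite f1 g1; split; ring.
- rewrite gN; split; last by ring.
  by rewrite -[RHS]fN; ring.
Qed.

Definition std_circle : set (point3 R) := range (fun t : R => (cos t, sin t, 0 : R)).

(* Over x = cos th there are two points, at (y, z) = mid(x) +- sin th * D(x); here
   mid and D are Chebyshev polynomials and D does not vanish, so that a translation
   followed by a similarity in each plane x = cst moves the curve to a circle. *)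
Lemma frequency_one (m n : nat) (a b c : R) : (0 < m)%N -> (0 < n)%N ->
  (forall s t : R, cos (s + a) = cos (t + a) ->
    cos (m%:R * s + b) = cos (m%:R * t + b) ->
    cos (n%:R * s + c) = cos (n%:R * t + c) -> congr2pi s t) ->
  knot_equiv (range (fun t : R =>
    (cos (t + a), cos (m%:R * t + b), cos (n%:R * t + c))))
             std_circle.
Proof.
move=> m0 n0 inj; have pi0 := pi_gt0 R.
have [f1 [g1 [cf1 cg1 E1 g11 [f1N g1N]]]] := chebyshev m.
have [f2 [g2 [cf2 cg2 E2 g21 [f2N g2N]]]] := chebyshev n.
pose b' := b - m%:R * a; pose c' := c - n%:R * a.
have bE th : m%:R * (th - a) + b = m%:R * th + b' by rewrite /b'; ring.
have cE th : n%:R * (th - a) + c = n%:R * th + c' by rewrite /c'; ring.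
have sym (k w : R) : sin k * sin w = 0 -> cos (k + w) = cos (- k + w).
  by move=> kw; rewrite !cosD cosN sinN mulNr kw !oppr0.
(* The times [th - a] and [- th - a] share the first coordinate, and share the others once these
   products vanish. *)
have inj' th : sin (m%:R * th) * sin b' = 0 -> sin (n%:R * th) * sin c' = 0 ->
    exists p : int, th = p%:~R * pi.
  move=> sb sc; have [|||p Hp] := inj (th - a) (- th - a).
  - by rewrite !subrK cosN.
  - by rewrite !bE mulrN; exact: sym.
  - by rewrite !cE mulrN; exact: sym.
  by exists p; lra.
(* Clamping freezes the polynomials outside the range of the cosine, so that [D1] and [D2] have no
   common zero there either. *)
pose X (x : R) := clamp (-1) 1 x.
pose D1 x := g1 (X x) * sin b'; pose D2 x := g2 (X x) * sin c'.
have cX : continuous X by apply: cts_clamp; exact: cts_id.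
have cD1 : continuous D1 by rewrite /D1; cts.
have cD2 : continuous D2 by rewrite /D2; cts.
have mR : m%:R != 0 :> R by rewrite pnatr_eq0 -lt0n.
have nR : n%:R != 0 :> R by rewrite pnatr_eq0 -lt0n.
have D0 x : D1 x * D1 x + D2 x * D2 x != 0.
  apply/negP; rewrite paddr_eq0 -?expr2 ?sqr_ge0 // !sqrf_eq0 => /andP[/eqP d1 /eqP d2].
  have X1 : -1 <= X x <= 1 by apply: clamp_bounds; lra.
  pose th := acos (X x); have thE : cos th = X x by rewrite acosK // in_itv.
  have [s0|s0] := eqVneq (sin th) 0; last first.
    have [||p Hp] := inj' th.
    - by rewrite (E1 th).2 thE -mulrA -/(D1 x) d1 mulr0.
    - by rewrite (E2 th).2 thE -mulrA -/(D2 x) d2 mulr0.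
    by move: s0; rewrite Hp sin_piz eqxx.
  have XX : X x = 1 \/ X x = -1.
    have : (X x - 1) * (X x + 1) = 0.
      have := cos2Dsin2 th; rewrite s0 thE => H.
      have -> : (X x - 1) * (X x + 1) = X x ^+ 2 + 0 ^+ 2 - 1 by ring.
      by rewrite H subrr.
    by move/eqP; rewrite mulf_eq0 => /orP[/eqP|/eqP] H; [left|right]; lra.
  have fN (f : R) : f * f = 1 -> f != 0 by move=> ff; apply/eqP => f0; move: ff;
    rewrite f0 mul0r; lra.
  (* At the ends the Chebyshev values are nonzero, so both sines vanish; the curve would then be
     traced back and forth, which the angle pi / 2 refutes. *)
  have [sb sc] : sin b' = 0 /\ sin c' = 0.
    move: d1 d2; rewrite /D1 /D2; case: XX => ->; rewrite ?g11 ?g21 ?g1N ?g2N;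
    by move=> /eqP + /eqP; rewrite !mulf_eq0 ?oppr_eq0 ?(negbTE mR) ?(negbTE nR)
      ?(negbTE (fN _ f1N)) ?(negbTE (fN _ f2N)) /= => /eqP-> /eqP->.
  have [||p Hp] := inj' (pi / 2); rewrite ?sb ?sc ?mulr0 //.
  have := sin_pihalf R; rewrite Hp sin_piz; lra.
(* In each plane: subtract the midpoint, then divide by the complex number D1 + i D2. The curve
   becomes (cos th, - sin th, 0), hence the reversed time [- (t + a)]. *)
pose h (p : point3 R) : point3 R :=
  let d := D1 p.1.1 * D1 p.1.1 + D2 p.1.1 * D2 p.1.1 in
  let y := p.1.2 - f1 (X p.1.1) * cos b' in let z := p.2 - f2 (X p.1.1) * cos c' in
  (p.1.1, (y * D1 p.1.1 + z * D2 p.1.1) / d, (z * D1 p.1.1 - y * D2 p.1.1) / d).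
pose h' (p : point3 R) : point3 R :=
  (p.1.1, p.1.2 * D1 p.1.1 - p.2 * D2 p.1.1 + f1 (X p.1.1) * cos b',
          p.1.2 * D2 p.1.1 + p.2 * D1 p.1.1 + f2 (X p.1.1) * cos c').
apply: (@knot_equiv_range _ _ _ h (fun t => - (t + a))).
- split; first by rewrite /h; cts => p; exact: D0.
  exists h'; split; first by rewrite /h'; cts.
    move=> [[x y] z]; rewrite /h /h' /=; move: (D0 x) => d0.
    by congr (_, _, _); field.
  move=> [[x y] z]; rewrite /h /h' /=; move: (D0 x) => d0.
  by congr (_, _, _); field.
- by move=> t; exists (- t - a); ring.
move=> t; have -> : t = (t + a) - a by rewrite addrK.
move: (t + a) => th; rewrite subrK bE cE /h /=.
rewrite (cosD (m%:R * th) b') (cosD (n%:R * th) c') (E1 th).1 (E1 th).2 (E2 th).1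
  (E2 th).2.
have XE : X (cos th) = cos th by rewrite /X clamp_id // cos_geN1 cos_le1.
have := D0 (cos th); rewrite /D1 /D2 XE => d0.
by rewrite cosN sinN; congr (_, _, _); field.
Qed.

Lemma swap12_equiv (f g k : R -> R) :
  knot_equiv (range (fun t => (f t, g t, k t))) (range (fun t => (g t, f t, k t))).
Proof.
pose h (p : point3 R) : point3 R := (p.1.2, p.1.1, p.2).
apply: (@knot_equiv_range _ _ _ h id) => //; last by move=> t; exists t.
by split; [rewrite /h; cts|exists h; split; [rewrite /h;
  cts|move=> [[? ?] ?]|move=> [[? ?] ?]]].
Qed.

Lemma swap13_equiv (f g k : R -> R) :
  knot_equiv (range (fun t => (f t, g t, k t))) (range (fun t => (k t, g t, f t))).
Proof.
pose h (p : point3 R) : point3 R := (p.2, p.1.2, p.1.1).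
apply: (@knot_equiv_range _ _ _ h id) => //; last by move=> t; exists t.
by split; [rewrite /h; cts|exists h; split; [rewrite /h;
  cts|move=> [[? ?] ?]|move=> [[? ?] ?]]].
Qed.

Lemma lissajous_frequency_one (nx ny nz : nat) (px py pz : R) :
  (0 < nx)%N -> (0 < ny)%N -> (0 < nz)%N ->
  [|| nx == 1%N, ny == 1%N | nz == 1%N] ->
  lissajous_embedded nx ny nz px py pz ->
  knot_equiv (range (lissajous nx ny nz px py pz)) std_circle.
Proof.
move=> x0 y0 z0 one /lissajous_embedded_2pi inj; rewrite /lissajous.
case/or3P: one => /eqP E; subst.
- have := @frequency_one ny nz px py pz y0 z0.
  under eq_fun => t do rewrite -[t in t + px]mul1r.
  by apply => s t H1 H2 H3; apply: inj; rewrite ?mul1r.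
- apply: (knot_equiv_trans (swap12_equiv _ _ _)).
  have := @frequency_one nx nz py px pz x0 z0.
  under eq_fun => t do rewrite -[t in t + py]mul1r.
  by apply => s t H1 H2 H3; apply: inj; rewrite ?mul1r.
- apply: (knot_equiv_trans (swap13_equiv _ _ _)).
  have := @frequency_one ny nx pz py px y0 x0.
  under eq_fun => t do rewrite -[t in t + pz]mul1r.
  by apply => s t H1 H2 H3; apply: inj; rewrite ?mul1r.
Qed.

End FrequencyOne.

(** * Counting *)

(* Residues modulo 2 N up to the reflection D |-> c - D: there are at most N + 1. *)
Lemma reflection_class (N : nat) (c D : int) : (0 < N)%N ->
  exists (m : 'I_N.+1) (j : int), let w := 2 * (val m)%:Z + (c %% 2)%Z in
  2 * D - c = 4 * N%:Z * j + w \/ 2 * D - c = 4 * N%:Z * j - w.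
Proof.
move=> N0.
pose b := (c %% 2)%Z; pose e := (c %/ 2)%Z.
have cE : c = e * 2 + b by exact: divz_eq.
have b0 : 0 <= b by exact: modz_ge0.
have b2 : b < 2 by exact: ltz_pmod.
have N2 : (2 * N%:Z) != 0 by lia.
have N2p : 0 < 2 * N%:Z by lia.
(* Here 2 D - c = 4 N q + 2 h + b with 0 <= h < 2 N; a remainder above N is folded to 2 N - h - b
   with the opposite sign. *)
rewrite -/b; move: (divz_eq (D - e - b) (2 * N%:Z)) (modz_ge0 (D - e - b) N2)
  (ltz_pmod (D - e - b) N2p).
move: ((D - e - b) %/ _)%Z ((D - e - b) %% _)%Z => q h hE h0 hN.
have [hN1|hN1] := leP h N%:Z.
  have hb : (`|h| < N.+1)%N by lia.
  exists (Ordinal hb), q => /=; left; rewrite gez0_abs //; nia.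
have hb : (`|(2 * N%:Z - h - b)%R| < N.+1)%N by lia.
exists (Ordinal hb), (q + 1) => /=; right; rewrite gez0_abs; nia.
Qed.

Lemma has_data_card (R : realType) (nx ny nz k : nat) (K : 'I_k -> set (point3 R)) :
  (0 < nx)%N -> (0 < ny)%N -> coprime nx ny ->
  (forall i, exists A B, has_data nx ny nz (K i) A B) ->
  (forall i j, i != j -> ~ knot_equiv (K i) (K j)) ->
  (k <= nx * ny + 1)%N.
Proof.
move=> x0 y0 nxy dat neq.
have N0 : (0 < nx * ny)%N by rewrite muln_gt0 x0.
have [l0 [k0 kl]] := coprime_solve 1 nxy.
have kk : k0 * ny%:Z - (- l0) * nx%:Z = 1 by rewrite -kl; ring.
(* This is the centre for which [has_data_reverse] acts as D |-> c - D; passing to 2 D - c turns it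
   into a change of sign, whatever the parity of c. *)
pose c : int := ny%:Z * (nz%:Z * k0 - 1) + nx%:Z * (nz%:Z * (- l0) - 1).
have /choice[F HF] : forall i, exists m : 'I_(nx * ny).+1, exists A B j : int,
    has_data nx ny nz (K i) A B /\
    (let w := 2 * (val m)%:Z + (c %% 2)%Z in let D := ny%:Z * A + nx%:Z * B in
     2 * D - c = 4 * (nx * ny)%N%:Z * j + w \/ 2 * D - c = 4 * (nx * ny)%N%:Z * j - w).
  move=> i; have [A [B d]] := dat i.
  have [m [j H]] := reflection_class c (ny%:Z * A + nx%:Z * B) N0.
  by exists m, A, B, j.
have Finj : injective F.
  move=> i1 i2 E; apply/eqP/negPn/negP => i12; apply: (neq _ _ i12).
  have [A1 [B1 [j1 [d1 /= H1]]]] := HF i1; have [A2 [B2 [j2 [d2 /= H2]]]] := HF i2.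
  rewrite E in H1; move: (2 * _ + (c %% 2)%Z) H1 H2 => w H1 H2.
  rewrite !PoszM in H1 H2.
  (* Equal signs give congruent values of D; opposite signs do so after reversing the second
     knot. *)
  have [H|H] : (2 * (ny%:Z * A1 + nx%:Z * B1) - c) - (2 * (ny%:Z * A2 + nx%:Z * B2) - c)
      = 4 * (nx%:Z * ny%:Z) * (j1 - j2) \/
    (2 * (ny%:Z * A1 + nx%:Z * B1) - c) + (2 * (ny%:Z * A2 + nx%:Z * B2) - c)
      = 4 * (nx%:Z * ny%:Z) * (j1 + j2).
    by case: H1 => ->; case: H2 => ->; [left|right|right|left]; ring.
  - apply: (has_data_equiv_mod x0 y0 nxy d1 d2 (j := j1 - j2)); lia.
  - have d2' := has_data_reverse x0 y0 kk d2.
    apply: (has_data_equiv_mod x0 y0 nxy d1 d2' (j := j1 + j2)).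
    by rewrite /c in H; lia.
have := leq_card F Finj; rewrite !card_ord; lia.
Qed.

Theorem theorem1 (R : realType) (nx ny nz : nat) :
  (0 < nx)%N -> (0 < ny)%N -> (0 < nz)%N ->
  coprime nx ny -> coprime ny nz -> coprime nx nz ->
  num_lissajous_types_le R nx ny nz (2 * nx * ny) /\
  (nx = 2%N -> num_lissajous_types_le R nx ny nz (2 * ny + 1)).
Proof.
move=> x0 y0 z0 nxy nyz nxz.
suff main : num_lissajous_types_le R nx ny nz (nx * ny + 1).
  split=> [k ph emb neq|nx2 k ph emb neq]; apply: (leq_trans (main k ph emb neq));
    last by rewrite nx2.
  have : (0 < nx * ny)%N by rewrite muln_gt0 x0.
  by rewrite -mulnA; lia.
move=> k ph emb neq.
have [one|/norP[x1 /norP[y1 z1]]] := boolP [|| nx == 1%N, ny == 1%N | nz == 1%N].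
  (* All curves are equivalent to one circle, so there is at most one class. *)
  have circ i := lissajous_frequency_one x0 y0 z0 one (emb i).
  case: k ph emb neq circ => [|[|k]] ph emb neq circ //; first by rewrite addn1.
  have := neq ord0 ord_max isT; case; rewrite !lissajous_knotE.
  exact: knot_equiv_trans (circ _) (knot_equiv_sym (circ _)).
apply: (@has_data_card R nx ny nz k (fun i =>
  range (lissajous nx ny nz (ph i).1.1 (ph i).1.2 (ph i).2))) => //.
  move=> i; have inj := lissajous_embedded_2pi (emb i).
  (* Each condition involves two frequencies and follows from embeddedness because the third exceeds
     1. *)
  apply: has_data_exists => // j.
  - apply: (@phases_not_piz R nx ny nz _ _ (ph i).2) => //.
    by rewrite ltn_neqAle eq_sym z1.
  - apply: (@phases_not_piz R nx nz ny _ _ (ph i).1.2) => //.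
      by rewrite ltn_neqAle eq_sym y1.
    by move=> s t h1 h2 h3; exact: inj.
  - apply: (@phases_not_piz R ny nz nx _ _ (ph i).1.1) => //.
      by rewrite ltn_neqAle eq_sym x1.
    by move=> s t h1 h2 h3; exact: inj.
by move=> i j ij; rewrite -!lissajous_knotE; exact: neq.
Qed.
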